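(* Let $G$ be a second countable compact group and let $G_0$ be a closed subgroup of $G$ with $[G:G_0]<+\infty$. Then $\mathcal{F}(\widehat{G}\cup\widehat{G_0})$, with the convolution $*$ and the involution given by complex conjugation of characters, is a fusion rule algebra if and only if $(G,G_0)$ is an admissible pair.
   Context: Notation. For a compact group $K$, $\widehat{K}$ is the set of equivalence classes of irreducible (unitary, finite-dimensional) representations of $K$, and $\mathrm{Rep}^{\mathrm f}(K)$ is the set of equivalence classes of finite-dimensional representations. For $\pi\in\mathrm{Rep}^{\mathrm f}(K)$ put $Ch(\pi)(g)=\mathrm{tr}(\pi(g))$ and $ch(\pi)=\frac{1}{\dim\pi}Ch(\pi)$. $\mathrm{res}_{G_0}^G$ and $\mathrm{ind}_{G_0}^G$ denote restriction to $G_0$ and (unitary) induction from $G_0$ to $G$. $\pi_0$ is the trivial representation of $G$. Admissible pair. For $g\in G_0$ let $X(g)=\{s\in G: sgs^{-1}\in G_0\}$. The pair $(G,G_0)$ is admissible if for every $\tau\in\widehat{G_0}$, every $g\in G_0$ and every $s\in X(g)$ one has $ch(\tau)(sgs^{-1})=ch(\tau)(g)$. The object $\mathcal{F}(\widehat{G}\cup\widehat{G_0})$. It is the set of formal symbols $$\mathcal{F}(\widehat{G}\cup\widehat{G_0})=\{(Ch(\pi),\circ),\,(Ch(\tau),\bullet):\pi\in\widehat{G},\ \tau\in\widehat{G_0}\},$$ a disjoint union of a copy of $\widehat{G}$ (marked $\circ$) and a copy of $\widehat{G_0}$ (marked $\bullet$). Let $\mathbb{C}\mathcal{F}(\widehat{G}\cup\widehat{G_0})$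 be the complex vector space of finite formal linear combinations of these symbols. If a finite-dimensional representation $\sigma$ of $G$ decomposes with multiplicities $m_\pi$, write $(Ch(\sigma),\circ)=\sum_{\pi\in\widehat G} m_\pi (Ch(\pi),\circ)$; similarly for representations of $G_0$ with $\bullet$. Products of characters are the characters of tensor products. The convolution $*$ is the bilinear extension of $$(Ch(\pi_i),\circ)*(Ch(\pi_j),\circ)=(Ch(\pi_i)Ch(\pi_j),\circ),$$ $$(Ch(\pi),\circ)*(Ch(\tau),\bullet)=(Ch(\mathrm{res}_{G_0}^G\pi)Ch(\tau),\bullet),$$ $$(Ch(\tau),\bullet)*(Ch(\pi),\circ)=(Ch(\tau)Ch(\mathrm{res}_{G_0}^G\pi),\bullet),$$ $$(Ch(\tau_i),\bullet)*(Ch(\tau_j),\bullet)=(Ch(\mathrm{ind}_{G_0}^G(\tau_i\otimes\tau_j)),\circ),$$ for $\pi_i,\pi_j,\pi\in\widehat G$ and $\tau_i,\tau_j,\tau\in\widehat{G_0}$. The involution is the conjugate-linear extension of $(Ch(\pi),\circ)\mapsto(\overline{Ch(\pi)},\circ)$, $(Ch(\tau),\bullet)\mapsto(\overline{Ch(\tau)},\bullet)$, and the distinguished unit element is $(Ch(\pi_0),\circ)$. Fusion rule algebra. A fusion rule algebra $F=(F,\mathbb{C}F,\circ,* )$ consists of a countable (possibly finite) discrete set $F=\{X_0,X_1,X_2,\dots\}$, the complex vector space $\mathbb{C}F$ of finite formal linear combinations of elements of $F$, an associative bilinear product (convolution) $\circ$ on $\mathbb{C}F$ and an involution $*$ on $\mathbb{C}F$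 such that: (F1) $(\mathbb{C}F,\circ,* )$ is an associative $*$-algebra with unit $X_0$; (F2) for $X_i,X_j\in F$, all coefficients of $X_i\circ X_j\in\mathbb{C}F$ in the basis $F$ are non-negative integers; (F3) $X_i^*\in F$ for every $X_i\in F$; moreover $X_j=X_i^*$ if and only if $X_0$ occurs with nonzero coefficient in $X_i\circ X_j$, and in this case its coefficient is $1$, i.e. $X_i\circ X_j=X_0+\sum_{X_k\neq X_0}a_{ij}^kX_k$. (In the application above, the abstract convolution is the operation written $*$ on $\mathcal{F}(\widehat{G}\cup\widehat{G_0})$ and the abstract involution is complex conjugation.) *)

(* Defs.v *)
From HB Require Import structures.
From mathcomp Require Import all_boot all_order all_algebra.
From mathcomp Require Import finmap.
From mathcomp Require Import all_classical all_reals topology normedtype.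
From mathcomp Require Import spectral complex mxtens.
(* The notations of monalg clash with those of the topology library. *)
From mathcomp Require Import -(notations) monalg.

Set Implicit Arguments.
Unset Strict Implicit.
Unset Printing Implicit Defensive.

Import Order.TTheory GRing.Theory Num.Theory.
Import numFieldNormedType.Exports.

Local Open Scope classical_set_scope.
Local Open Scope ring_scope.

HB.mixin Record isTopologicalGroup G of Topological G & Group G := {
  mulg_continuous : continuous (fun x : G * G => (x.1 * x.2)%g);
  invg_continuous : continuous (fun x : G => x^-1%g)
}.

#[short(type="topologicalGroupType")]
HB.structure Definition TopologicalGroup :=
  {G of Topological G & Group G & isTopologicalGroup G}.

(* The complex vector space of finite formal linear combinations of the
   elements of F. *)
Notation "{ 'formal' C [ F ] }" := (malg F C)
  (at level 0, C, F at level 2, format "{ 'formal'  C [ F ] }") : type_scope.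
Notation fbasis x := (mkmalgU x 1).
Notation fcoef := mcoeff.
Notation fsupp := msupp.

Section FusionRuleAlgebra.

Variables (C : numClosedFieldType) (F : choiceType).
Local Notation CF := {formal C[F]}.

Definition bilinear_ext (m : F -> F -> CF) (a b : CF) : CF :=
  \sum_(x <- fsupp a) \sum_(y <- fsupp b) (fcoef x a * fcoef y b) *: m x y.

Definition conj_linear_ext (s : F -> CF) (a : CF) : CF :=
  \sum_(x <- fsupp a) (fcoef x a)^* *: s x.

Record fusion_rule_algebra (X0 : F) (conv : CF -> CF -> CF) (star : CF -> CF)
    : Prop := FusionRuleAlgebra {
  fra_countable : countable [set: F];
  fra_linearl : forall (k : C) (a b c : CF),
    conv (k *: a + b) c = k *: conv a c + conv b c;
  fra_linearr : forall (k : C) (a b c : CF),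
    conv a (k *: b + c) = k *: conv a b + conv a c;
  fra_assoc : associative conv;
  fra_unitl : left_id (fbasis X0) conv;
  fra_unitr : right_id (fbasis X0) conv;
  fra_star_linear : forall (k : C) (a b : CF),
    star (k *: a + b) = k^* *: star a + star b;
  fra_starK : involutive star;
  fra_starM : forall a b : CF, star (conv a b) = conv (star b) (star a);
  fra_coef_nat : forall x y z : F,
    exists n : nat, fcoef z (conv (fbasis x) (fbasis y)) = n%:R;
  fra_star_basis : forall x : F, exists y : F, star (fbasis x) = fbasis y;
  fra_star_iff : forall x y : F,
    fbasis y = star (fbasis x) <->
    fcoef X0 (conv (fbasis x) (fbasis y)) != 0;
  fra_star_coef : forall x y : F,
    fbasis y = star (fbasis x) ->
    fcoef X0 (conv (fbasis x) (fbasis y)) = 1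
}.

End FusionRuleAlgebra.

(* C stands for the complex numbers R[i], R : realType. It is kept abstract
   because the norm topology is attached to an abstract numClosedFieldType and
   is not found on the literal type R[i]. *)
Section Representations.

Variables (C : numClosedFieldType) (G : topologicalGroupType).

(* Finite-dimensional representations are matrix-valued functions on the
   ambient group G; for a subgroup H of G, all notions "over H" below only
   involve the values taken on H. In particular the restriction of a
   representation to a subgroup has the same underlying function. *)
Record rep := Rep { rdim : nat; rmx :> G -> 'M[C]_rdim }.

HB.instance Definition _ := gen_eqMixin rep.
HB.instance Definition _ := gen_choiceMixin rep.

Implicit Types (H : set G) (rho sigma : rep).

Definition unitary_rep H rho : Prop :=
  [/\ rho 1%g = 1%:M,
      {in H &, forall x y, rho (x * y)%g = rho x *m rho y},
      forall x, H x -> rho x \is unitarymx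
    & {within H, continuous (rho : G -> 'M[C]_(rdim rho))}].

(* Group elements act on column vectors; the row space of U encodes the
   subspace {u^T} of columns, whence the transpose. *)
Definition irreducible_rep H rho : Prop :=
  (0 < rdim rho)%N /\
  forall U : 'M[C]_(rdim rho),
    (forall x, H x -> stablemx U (rho x)^T) -> U = 0 \/ row_full U.

Definition equiv_rep H rho sigma : Prop :=
  exists (P : 'M[C]_(rdim sigma, rdim rho)) (Q : 'M[C]_(rdim rho, rdim sigma)),
    [/\ P *m Q = 1%:M, Q *m P = 1%:M
      & forall x, H x -> P *m rho x = sigma x *m P].

Definition Ch rho (x : G) : C := \tr (rho x).

Definition ch rho (x : G) : C := (rdim rho)%:R^-1 * Ch rho x.

Definition triv_rep : rep := @Rep 1 (fun=> 1%:M).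

Definition zero_rep : rep := @Rep 0 (fun=> 0).

Definition add_rep rho sigma : rep :=
  Rep (fun x => block_mx (rho x) 0 0 (sigma x)).

Definition sum_rep (s : seq rep) : rep := foldr add_rep zero_rep s.

Definition tens_rep rho sigma : rep := Rep (fun x => rho x *t sigma x).

Definition conj_rep rho : rep := Rep (fun x => map_mx Num.conj (rho x)).

Definition unitary_class H rho : set rep :=
  [set sigma | unitary_rep H sigma /\ equiv_rep H rho sigma].

(* The dual of H: equivalence classes of irreducible unitary
   representations. As a set, it coerces to the type of its elements. *)
Definition dual H : set (set rep) :=
  [set c | exists rho,
    [/\ unitary_rep H rho, irreducible_rep H rho & c = unitary_class H rho]].

Definition dual_rep H (p : dual H) : rep := xget zero_rep (val p).

(* The irreducible constituents of sigma, each repeated according to its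
   multiplicity: by complete reducibility every unitary representation of a
   subgroup H has such a decomposition, unique up to order. *)
Definition constituents H sigma : seq (dual H) :=
  xget [::]
    [set s : seq (dual H) |
      equiv_rep H sigma (sum_rep [seq dual_rep p | p <- s])].

Lemma triv_rep_dual H : unitary_class H triv_rep \in dual H.
Proof.
rewrite inE; exists triv_rep; split=> //.
- split=> //=.
  + by move=> x y _ _; rewrite mulmx1.
  + by move=> x _; apply/unitarymxP; rewrite trmx1 map_mx1 mulmx1.
  + exact: continuous_subspaceT (@cst_continuous _ _ _).
- split=> //= U _; have [->|U0] := eqVneq U 0; [by left | right].
  by rewrite -col_leq_rank lt0n mxrank_eq0.
Qed.

Definition triv_dual H : dual H := SigSub (triv_rep_dual H).

(* An arbitrary list containing exactly one representative of each left
   coset of H; such a list exists when H is a subgroup of finite index. *)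
Definition left_transversal H : seq G :=
  xget [::]
    [set s : seq G |
      forall x : G, count (fun t => t^-1 * x \in H)%g s = 1%N].

(* In the basis given by the left transversal (t_i), the space of the induced
   representation is the orthogonal sum of the translates by the t_i of the
   space of rho. *)
Definition ind_rep H rho : rep :=
  let t := tnth (in_tuple (left_transversal H)) in
  Rep (fun x => \mxblock_(i, j)
         (if ((t i)^-1 * x * t j)%g \in H
          then rho ((t i)^-1 * x * t j)%g else 0)).

Definition is_subgroup H : Prop :=
  H 1%g /\ (forall x y, H x -> H y -> H (x * y^-1)%g).

Definition left_cosets H : set (set G) :=
  range (fun x : G => [set (x * h)%g | h in H]).

Definition Xset H (x : G) : set G := [set s | H (s * x * s^-1)%g].

Definition admissible H : Prop :=
  forall tau, unitary_rep H tau -> irreducible_rep H tau ->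
  forall g, H g -> forall s, Xset H g s ->
  ch tau (s * g * s^-1)%g = ch tau g.

End Representations.

Arguments dual C {G} H.
Arguments triv_dual C {G} H.
Arguments admissible C {G} H.

Section FusionSymbols.

Variables (C : numClosedFieldType) (G : topologicalGroupType) (G0 : set G).

(* inl marks the symbols with a white circle, inr those with a bullet. *)
Definition symbols : choiceType := (dual C [set: G] + dual C G0)%type.

Local Notation CF := {formal C[symbols]}.

Definition white (sigma : rep C G) : CF :=
  \sum_(p <- constituents [set: G] sigma) fbasis (inl p : symbols).

Definition black (sigma : rep C G) : CF :=
  \sum_(p <- constituents G0 sigma) fbasis (inr p : symbols).

Definition symbol_mul (x y : symbols) : CF :=
  match x, y with
  | inl p, inl q => white (tens_rep (dual_rep p) (dual_rep q))
  | inl p, inr q => black (tens_rep (dual_rep p) (dual_rep q))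
  | inr p, inl q => black (tens_rep (dual_rep p) (dual_rep q))
  | inr p, inr q => white (ind_rep G0 (tens_rep (dual_rep p) (dual_rep q)))
  end.

Definition symbol_conj (x : symbols) : CF :=
  match x with
  | inl p => white (conj_rep (dual_rep p))
  | inr p => black (conj_rep (dual_rep p))
  end.

Definition symbol_unit : symbols := inl (triv_dual C [set: G]).

Definition symbols_conv : CF -> CF -> CF := bilinear_ext symbol_mul.

Definition symbols_star : CF -> CF := conj_linear_ext symbol_conj.

End FusionSymbols.

Arguments symbol_unit C {G} G0.
Arguments symbols_conv C {G} G0.
Arguments symbols_star C {G} G0.

(* Main.v *)
Require Import Defs.
From HB Require Import structures.
From mathcomp Require Import all_boot all_order all_algebra.
From mathcomp Require Import finmap.
From mathcomp Require Import all_classical all_reals topology normedtype.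
From mathcomp Require Import spectral complex mxtens.
From mathcomp Require Import -(notations) monalg.
From mathcomp Require Import ring lra.

Set Implicit Arguments.
Unset Strict Implicit.
Unset Printing Implicit Defensive.

Import Order.TTheory GRing.Theory Num.Theory.
Import numFieldNormedType.Exports.

Local Open Scope classical_set_scope.
Local Open Scope ring_scope.

(** The proof reads everything off characters. A formal sum a of symbols
    carries two functions: f on G, the combination of the characters of its
    white symbols, and k on G0, called H below, the combination of the
    characters of its black symbols. Irreducible characters are linearly independent, so a is
    determined by the pair (f, k) (symbols_eq), and the two operations become
    (f, k) * (f', k') = (f f' + Ind (k k'), f k' + k f'), where
      Ind k (x) = sum of k (t^-1 x t) over the coset representatives t of G0
                  such that t^-1 x t lies in G0,
    and complex conjugation (wchar_conv, bchar_conv, wchar_star, bchar_star).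
    The axioms of a fusion rule algebra are thereby turned into identities
    between functions, and only two of them have content.

    Associativity. The projection formula Ind (k) f = Ind (k f), for f a class
    function on G, reduces it to the identity
    Ind (k k') k'' = k Ind (k' k'') on G0. If the pair is admissible, the
    characters of G0 take the same value at x and at t^-1 x t, so that both
    sides are Ind 1 times k k' k''. Conversely, associativity for the black
    symbols of tau, 1, 1 says that Ch tau * Ind 1 = Ind (Ch tau) on G0; both
    Ind 1 and Ind (Ch tau) are class functions on G, and Ind 1 does not vanish
    on G0, so Ch tau is constant on the traces on G0 of the conjugacy classes
    of G.

    The coefficient of the unit in a product of two symbols. It is the mean
    value of a character of G. For two white symbols, Schur orthogonality
    evaluates it (character_orthogonality); for two black ones, Frobenius
    reciprocity first brings it back to a mean value over G0
    (Frobenius_average).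

    Mean values do not need a Haar measure. For a unitary representation, the
    orthogonal projection of the identity matrix onto the orthogonal complement
    of the span of the matrices sigma h - 1 is an affine combination of the
    sigma h, and it projects onto the invariant vectors
    (exists_invariant_average1); one list of weighted points serves for
    finitely many representations at once. This projection is moreover a limit
    of convex combinations of the sigma h (convex_approximation). Averaging
    the square of the modulus of the difference of two distinct irreducible
    characters, which has mean value 2, shows that this difference cannot be
    uniformly small (dual_separated). As the group is compact and second
    countable, each character is known up to a small error from finitely many
    basic open sets and rational values; hence the dual is countable
    (countable_dual). *)

Local Notation "M ^*t" := (map_mx Num.conj (trmx M)) (at level 8) : ring_scope.

(** * The Hilbert-Schmidt inner product and finite spanning families *)

Section Matrices.
Variable C : numClosedFieldType.

Definition hsdot m n (A B : 'M[C]_(m, n)) : C := \tr (A *m B^*t).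

Lemma hsdotE m n (A B : 'M[C]_(m, n)) :
  hsdot A B = \sum_i \sum_j A i j * (B i j)^*.
Proof.
rewrite /hsdot /mxtrace; apply: eq_bigr => i _; rewrite mxE.
by apply: eq_bigr => j _; rewrite !mxE.
Qed.

Lemma hsdot_mxvec m n (A B : 'M[C]_(m, n)) :
  (mxvec A *m (mxvec B)^*t) 0 0 = hsdot A B.
Proof.
rewrite hsdotE mxE pair_bigA /=.
rewrite (reindex _ (curry_mxvec_bij _ _)) /=.
by apply: eq_bigr => -[i j] _; rewrite !mxE !mxvecE.
Qed.

Lemma hsdotDl m n (A A' B : 'M[C]_(m, n)) :
  hsdot (A + A') B = hsdot A B + hsdot A' B.
Proof. by rewrite /hsdot mulmxDl linearD. Qed.

Lemma hsdotZl m n k (A B : 'M[C]_(m, n)) : hsdot (k *: A) B = k * hsdot A B.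
Proof. by rewrite /hsdot -scalemxAl linearZ. Qed.

Lemma hsdotC m n (A B : 'M[C]_(m, n)) : hsdot A B = (hsdot B A)^*.
Proof.
rewrite !hsdotE rmorph_sum; apply: eq_bigr => i _; rewrite rmorph_sum.
by apply: eq_bigr => j _; rewrite rmorphM /= conjCK mulrC.
Qed.

Lemma hsdotDr m n (A B B' : 'M[C]_(m, n)) :
  hsdot A (B + B') = hsdot A B + hsdot A B'.
Proof. by rewrite hsdotC hsdotDl rmorphD /= -!hsdotC. Qed.

Lemma hsdotZr m n k (A B : 'M[C]_(m, n)) : hsdot A (k *: B) = k^* * hsdot A B.
Proof. by rewrite hsdotC hsdotZl rmorphM /= -!hsdotC. Qed.

Lemma hsdotNl m n (A B : 'M[C]_(m, n)) : hsdot (- A) B = - hsdot A B.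
Proof. by rewrite -scaleN1r hsdotZl mulN1r. Qed.

Lemma hsdotNr m n (A B : 'M[C]_(m, n)) : hsdot A (- B) = - hsdot A B.
Proof. by rewrite -scaleN1r hsdotZr rmorphN1 mulN1r. Qed.

Lemma hsdot_sumr m n I (s : seq I) (F : I -> 'M[C]_(m, n)) A :
  hsdot A (\sum_(i <- s) F i) = \sum_(i <- s) hsdot A (F i).
Proof.
elim: s => [|i s IH]; last by rewrite !big_cons hsdotDr IH.
by rewrite !big_nil /hsdot trmx0 map_mx0 mulmx0 linear0.
Qed.

Lemma hsdot_ge0 m n (A : 'M[C]_(m, n)) : 0 <= hsdot A A.
Proof.
rewrite hsdotE; apply: sumr_ge0 => i _; apply: sumr_ge0 => j _.
exact: mul_conjC_ge0.
Qed.

Lemma hsdot_eq0 m n (A : 'M[C]_(m, n)) : hsdot A A = 0 -> A = 0.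
Proof.
have pos i j : 0 <= A i j * (A i j)^* by exact: mul_conjC_ge0.
rewrite hsdotE => A0; apply/matrixP=> i j; rewrite mxE.
apply/eqP; rewrite -mul_conjC_eq0; apply/eqP.
have /psumr_eq0P := A0 => /(_ _)/(_ i) A1.
have /psumr_eq0P : \sum_j A i j * (A i j)^* = 0.
  by apply: A1 => // k _; apply: sumr_ge0.
by move=> /(_ _)/(_ j); apply.
Qed.

Lemma map_conj_mul m n p (A : 'M[C]_(m, n)) (B : 'M[C]_(n, p)) :
  (A *m B)^*t = B^*t *m A^*t.
Proof. by rewrite trmx_mul map_mxM. Qed.

Lemma tr_conjK m n (A : 'M[C]_(m, n)) : (A^*t)^*t = A.
Proof. exact: trmxCK. Qed.

(* adjointness of left multiplication *)
Lemma hsdot_mull m n (T : 'M[C]_m) (A B : 'M[C]_(m, n)) :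
  hsdot (T *m A) B = hsdot A (T^*t *m B).
Proof.
by rewrite /hsdot map_conj_mul tr_conjK mulmxA -mulmxA mxtrace_mulC.
Qed.

Lemma hsdot_unitaryr m n (T : 'M[C]_n) (A : 'M[C]_(m, n)) :
  T \is unitarymx -> hsdot (A *m T) (A *m T) = hsdot A A.
Proof.
move=> /unitarymxP TT.
by rewrite /hsdot map_conj_mul mulmxA -[A *m T *m _]mulmxA TT mulmx1.
Qed.

(** Cauchy-Schwarz against the identity matrix. *)
Lemma mxtrace_hsdot n (A : 'M[C]_n) : `|\tr A| ^+ 2 <= n%:R * hsdot A A.
Proof.
have trE : \tr A = hsdot A 1%:M by rewrite /hsdot trmx1 map_mx1 mulmx1.
have nE : hsdot (1%:M : 'M[C]_n) 1%:M = n%:R.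
  by rewrite /hsdot trmx1 map_mx1 mulmx1 mxtrace1.
rewrite -nE trE -!hsdot_mxvec -!dotmxE mulrC.
exact: (CauchySchwarz (@dotmx C _)).
Qed.

Lemma hsdot_parallelogram m n (A B : 'M[C]_(m, n)) :
  hsdot (A + B) (A + B) + hsdot (A - B) (A - B) = 2%:R * (hsdot A A + hsdot B B).
Proof. by rewrite !(hsdotDl, hsdotDr, hsdotNl, hsdotNr); ring. Qed.

Lemma sub_span (T : Type) n (v : T -> 'rV[C]_n) (hs : seq T) (w : 'rV[C]_n) :
  (w <= \sum_(h <- hs) <<v h>>)%MS ->
  exists m : seq (C * T),
    [seq p.2 | p <- m] = hs /\ w = \sum_(p <- m) p.1 *: v p.2.
Proof.
elim: hs w => [|h hs IH] w.
  by rewrite big_nil submx0 => /eqP->; exists [::]; rewrite big_nil.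
rewrite big_cons => /sub_addsmxP[[a b] /= wE].
have /sub_rVP[k kE] : (a *m <<v h>> <= v h)%MS.
  by apply: submx_trans (submxMl _ _) _; rewrite genmxE.
have [m [mE bE]] := IH _ (submxMl b (\sum_(h0 <- hs) <<v h0>>)%MS).
by exists ((k, h) :: m) => /=; rewrite mE big_cons -kE -bE.
Qed.

(** Among the finite lists of elements of D, take one whose span has maximal
    rank. *)
Lemma finite_span (T : eqType) (D : T -> Prop) n (v : T -> 'rV[C]_n) :
  exists hs : seq T, {in hs, forall x, D x} /\
    forall x, D x -> (v x <= \sum_(h <- hs) <<v h>>)%MS.
Proof.
apply: contrapT => nspan.
suff big k : exists hs,
    {in hs, forall x, D x} /\ (k <= \rank (\sum_(h <- hs) <<v h>>)%MS)%N.
  have [hs [_]] := big n.+1.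
  by rewrite ltnNge rank_leq_col.
elim: k => [|k [hs [Dhs rk]]]; first by exists [::].
have [x [Dx vx]] : exists x, D x /\ ~~ (v x <= \sum_(h <- hs) <<v h>>)%MS.
  apply: contrapT => no; apply: nspan; exists hs; split => // x Dx.
  by apply: contrapT => /negP nx; apply: no; exists x.
exists (x :: hs); split; first by move=> y; rewrite inE => /predU1P[->//|/Dhs].
apply: (leq_ltn_trans rk); rewrite big_cons.
apply: rank_ltmx; rewrite ltmxE addsmxSr /=.
apply: contra vx; apply: submx_trans.
by apply: submx_trans (addsmxSl _ _); rewrite genmxE.
Qed.

End Matrices.

(** * Continuity of matrix-valued functions *)

Section Continuity.
Variables (C : numClosedFieldType) (T : topologicalType) (A : set T).

Lemma within_mxP m n (f : T -> 'M[C]_(m, n)) :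
  {within A, continuous f} <->
  forall i j, {within A, continuous (fun x => f x i j)}.
Proof.
split=> [fc i j|fc].
  move=> x; apply: (@continuous_comp _ _ _ (f : subspace A -> _)
    (fun M : 'M[C]_(m, n) => M i j)); first exact: fc.
  exact: coord_continuous.
move=> x W [P PW sPW].
apply: (@filterS _ (nbhs (x : subspace A)) _
  [set y : subspace A | forall ij : 'I_m * 'I_n, P ij.1 ij.2 (f y ij.1 ij.2)]).
  by move=> y Py; apply: sPW => i j; exact: (Py (i, j)).
apply: (@filter_forall (subspace A)) => -[i j] /=.
exact: (fc i j x _ (PW i j)).
Qed.

Lemma within_mulmx m n p (f : T -> 'M[C]_(m, n)) (g : T -> 'M[C]_(n, p)) :
  {within A, continuous f} -> {within A, continuous g} ->
  {within A, continuous (fun x => f x *m g x)}.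
Proof.
move=> /within_mxP fc /within_mxP gc; apply/within_mxP => i j.
have -> : (fun x => (f x *m g x) i j) = (fun x => \sum_k f x i k * g x k j).
  by apply/funext => x; rewrite mxE.
move=> x; apply: cvg_big => [|k _]; first exact: add_continuous.
by apply: cvgM; [exact: (fc i k x)|exact: (gc k j x)].
Qed.

Lemma within_cst (U : topologicalType) (c : U) : {within A, continuous (fun=> c)}.
Proof. by apply: continuous_subspaceT => x; exact: cvg_cst. Qed.

Lemma within_block m n p q (f : T -> 'M[C]_(m, n)) (g : T -> 'M[C]_(p, q)) :
  {within A, continuous f} -> {within A, continuous g} ->
  {within A, continuous (fun x => block_mx (f x) 0 0 (g x))}.
Proof.
move=> /within_mxP fc /within_mxP gc; apply/within_mxP => i j.
case: (split_ordP i) => i' ->; case: (split_ordP j) => j' ->.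
- by under [X in continuous X]eq_fun do rewrite block_mxEul; exact: fc.
- under [X in continuous X]eq_fun do rewrite block_mxEur mxE; exact: within_cst.
- under [X in continuous X]eq_fun do rewrite block_mxEdl mxE; exact: within_cst.
- by under [X in continuous X]eq_fun do rewrite block_mxEdr; exact: gc.
Qed.

Lemma within_tensmx m n p q (f : T -> 'M[C]_(m, n)) (g : T -> 'M[C]_(p, q)) :
  {within A, continuous f} -> {within A, continuous g} ->
  {within A, continuous (fun x => f x *t g x)}.
Proof.
move=> /within_mxP fc /within_mxP gc; apply/within_mxP => i j.
case: (mxtens_indexP i) => i1 i2; case: (mxtens_indexP j) => j1 j2.
under [X in continuous X]eq_fun do rewrite tensmxE.
by move=> x; apply: cvgM; [exact: (fc i1 j1 x)|exact: (gc i2 j2 x)].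
Qed.

Lemma within_conjmx m n (f : T -> 'M[C]_(m, n)) :
  {within A, continuous f} ->
  {within A, continuous (fun x => map_mx Num.conj (f x))}.
Proof.
move=> /within_mxP fc; apply/within_mxP => i j.
under [X in continuous X]eq_fun do rewrite mxE.
move=> x; apply/cvgrPdist_lt => e e0.
have /cvgrPdist_lt/(_ e e0) := fc i j x.
by apply: filterS => y; rewrite -rmorphB norm_conjC.
Qed.

Lemma within_mxtrace n (f : T -> 'M[C]_n) :
  {within A, continuous f} -> {within A, continuous (fun x => \tr (f x))}.
Proof.
move=> /within_mxP fc x; apply: cvg_big => [|k _]; first exact: add_continuous.
exact: (fc k k x).
Qed.

End Continuity.

(** * Operations on representations *)

Section Reps.
Variables (C : numClosedFieldType) (G : topologicalGroupType) (H : set G).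
Hypothesis subgroupH : is_subgroup H.
Implicit Types rho sigma tau : rep C G.

Lemma subgroup1 : H 1%g. Proof. by case: subgroupH. Qed.

Lemma subgroupV x : H x -> H x^-1%g.
Proof. by case: subgroupH => H1 HM Hx; rewrite -[x^-1%g]mul1g; apply: HM. Qed.

Lemma subgroupM x y : H x -> H y -> H (x * y)%g.
Proof.
case: subgroupH => _ HM Hx /subgroupV Hy.
by rewrite -[y]invgK; exact: HM.
Qed.

Section Unitary.
Variable rho : rep C G.
Hypothesis rhoU : unitary_rep H rho.

Lemma rep1 : rho 1%g = 1%:M. Proof. by case: rhoU. Qed.

Lemma repM x y : H x -> H y -> rho (x * y)%g = rho x *m rho y.
Proof. by case: rhoU => _ rM _ _ Hx Hy; apply: rM; apply: mem_set. Qed.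

Lemma rep_unitary x : H x -> rho x \is unitarymx.
Proof. by case: rhoU => _ _ rU _; exact: rU. Qed.

Lemma repV x : H x -> rho x^-1%g = (rho x)^*t.
Proof.
move=> Hx; have /unitarymxP rxU := rep_unitary Hx.
have := repM (subgroupV Hx) Hx; rewrite mulVg rep1.
move=> /(congr1 (fun M => M *m (rho x)^*t)).
by rewrite mul1mx -mulmxA rxU mulmx1 => <-.
Qed.

End Unitary.

Lemma equiv_rep_refl rho : equiv_rep H rho rho.
Proof. by exists 1%:M, 1%:M; split=> *; rewrite ?mulmx1 ?mul1mx. Qed.

Lemma equiv_rep_sym rho sigma : equiv_rep H rho sigma -> equiv_rep H sigma rho.
Proof.
move=> [P [Q [PQ QP PE]]]; exists Q, P; split=> // x Hx.
by rewrite -[LHS]mulmx1 -PQ mulmxA -[Q *m _ *m P]mulmxA -PE // mulmxA QP mul1mx.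
Qed.

Lemma equiv_rep_trans sigma rho tau :
  equiv_rep H rho sigma -> equiv_rep H sigma tau -> equiv_rep H rho tau.
Proof.
move=> [P [Q [PQ QP PE]]] [P' [Q' [PQ' QP' PE']]].
exists (P' *m P), (Q *m Q'); split=> [||x Hx].
- by rewrite mulmxA -[P' *m P *m Q]mulmxA PQ mulmx1.
- by rewrite mulmxA -[Q *m Q' *m P']mulmxA QP' mulmx1.
- by rewrite -mulmxA PE // !mulmxA PE'.
Qed.

Lemma equiv_add rho rho' sigma sigma' :
  equiv_rep H rho rho' -> equiv_rep H sigma sigma' ->
  equiv_rep H (add_rep rho sigma) (add_rep rho' sigma').
Proof.
move=> [P [Q [PQ QP PE]]] [P' [Q' [PQ' QP' PE']]].
exists (block_mx P 0 0 P'), (block_mx Q 0 0 Q').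
split=> [||x Hx]; rewrite /= !mulmx_block !(mulmx0, mul0mx, addr0, add0r).
- by rewrite PQ PQ' -scalar_mx_block.
- by rewrite QP QP' -scalar_mx_block.
- by rewrite PE // PE'.
Qed.

Lemma equiv_cast n n' (e : n = n') (f : G -> 'M[C]_n) :
  equiv_rep H (Rep f) (Rep (fun x => castmx (e, e) (f x))).
Proof.
case: n' / e; exists 1%:M, 1%:M.
by split=> *; rewrite ?mulmx1 ?mul1mx // castmx_id.
Qed.

Lemma equiv_addA rho sigma tau :
  equiv_rep H (add_rep rho (add_rep sigma tau)) (add_rep (add_rep rho sigma) tau).
Proof.
have e := addnA (rdim rho) (rdim sigma) (rdim tau).
suff -> : add_rep (add_rep rho sigma) tau =
    Rep (fun x => castmx (e, e) (add_rep rho (add_rep sigma tau) x)).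
  by case: rho sigma tau e => [n r] [n' s] [n'' t] e; exact: equiv_cast.
congr Rep; apply/funext => x /=.
have := @block_mxA _ _ _ _ _ _ _ (rho x) 0 0 0 (sigma x) 0 0 0 (tau x).
rewrite /= !row_mx0 !col_mx0 => ->; rewrite castmx_comp.
by rewrite (eq_irrelevance (etrans _ _) erefl) castmx_id.
Qed.

Lemma equiv_add0 rho : equiv_rep H (add_rep (zero_rep C G) rho) rho.
Proof.
suff -> : add_rep (zero_rep C G) rho = rho by exact: equiv_rep_refl.
case: rho => n r; congr Rep; apply/funext => x /=; apply/matrixP => i j.
have -> : i = rshift 0 i by apply/val_inj.
have -> : j = rshift 0 j by apply/val_inj.
by rewrite block_mxEdr; congr (r x _ _); exact/val_inj.
Qed.

Lemma Ch_equiv rho sigma x : equiv_rep H rho sigma -> H x -> Ch rho x = Ch sigma x.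
Proof.
move=> [P [Q [PQ QP PE]]] Hx.
by rewrite /Ch -[sigma x]mulmx1 -PQ mulmxA -PE // mxtrace_mulC mulmxA QP mul1mx.
Qed.

Lemma Ch_add rho sigma x : Ch (add_rep rho sigma) x = Ch rho x + Ch sigma x.
Proof. exact: mxtrace_block. Qed.

Lemma Ch_zero x : Ch (zero_rep C G) x = 0.
Proof. exact: linear0. Qed.

Lemma Ch_sum (s : seq (rep C G)) x : Ch (sum_rep s) x = \sum_(r <- s) Ch r x.
Proof.
by elim: s => [|r s IH]; rewrite ?big_nil ?Ch_zero // big_cons -IH -Ch_add.
Qed.

Lemma Ch_tens rho sigma x : Ch (tens_rep rho sigma) x = Ch rho x * Ch sigma x.
Proof.
rewrite /Ch /mxtrace mulr_sum; apply: eq_bigr => i _.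
by case: (mxtens_indexP i) => i1 i2; rewrite tensmxE mxtens_indexK.
Qed.

Lemma Ch_conj rho x : Ch (conj_rep rho) x = (Ch rho x)^*.
Proof. by rewrite /Ch /mxtrace rmorph_sum; apply: eq_bigr => i _; rewrite mxE. Qed.

Lemma Ch_triv x : Ch (triv_rep C G) x = 1.
Proof. exact: mxtrace1. Qed.

Lemma unitary_triv : unitary_rep H (triv_rep C G).
Proof.
split=> //= [x y _ _|x _|]; first by rewrite mulmx1.
  by apply/unitarymxP; rewrite trmx1 map_mx1 mulmx1.
exact: within_cst.
Qed.

Lemma unitary_zero : unitary_rep H (zero_rep C G).
Proof.
split=> //= [|x y _ _|x _|]; try by apply/matrixP => -[].
  by apply/unitarymxP/matrixP => -[].
exact: within_cst.
Qed.

Lemma unitary_add rho sigma : unitary_rep H rho -> unitary_rep H sigma ->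
  unitary_rep H (add_rep rho sigma).
Proof.
move=> rU sU; split=> /= [|x y /set_mem Hx /set_mem Hy|x Hx|].
- by rewrite !rep1 // -scalar_mx_block.
- by rewrite mulmx_block !(mulmx0, mul0mx, addr0, add0r) !repM.
- apply/unitarymxP; rewrite tr_block_mx map_block_mx !trmx0 !map_mx0.
  rewrite mulmx_block !(mulmx0, mul0mx, addr0, add0r).
  rewrite (unitarymxP (rep_unitary rU Hx)) (unitarymxP (rep_unitary sU Hx)).
  by rewrite -scalar_mx_block.
- by apply: within_block; [case: rU|case: sU].
Qed.

Lemma unitary_sum (s : seq (rep C G)) :
  {in s, forall r, unitary_rep H r} -> unitary_rep H (sum_rep s).
Proof.
elim: s => [|r s IH] sU; first exact: unitary_zero.
apply: unitary_add; first by apply: sU; rewrite mem_head.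
by apply: IH => r' r's; apply: sU; rewrite inE r's orbT.
Qed.

Lemma unitary_tens rho sigma : unitary_rep H rho -> unitary_rep H sigma ->
  unitary_rep H (tens_rep rho sigma).
Proof.
have tens11 m n : (1%:M : 'M[C]_m) *t (1%:M : 'M[C]_n) = 1%:M.
  apply/matrixP => i j; case: (mxtens_indexP i) => i1 i2.
  case: (mxtens_indexP j) => j1 j2; rewrite tensmxE !mxE -natrM mulnb.
  by rewrite (can_eq (@mxtens_indexK _ _)).
move=> rU sU; split=> /= [|x y /set_mem Hx /set_mem Hy|x Hx|].
- by rewrite !rep1.
- by rewrite !repM // tensmx_mul.
- apply/unitarymxP; rewrite trmx_tens map_mxT tensmx_mul.
  by rewrite (unitarymxP (rep_unitary rU Hx)) (unitarymxP (rep_unitary sU Hx)).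
- by apply: within_tensmx; [case: rU|case: sU].
Qed.

Lemma unitary_conj rho : unitary_rep H rho -> unitary_rep H (conj_rep rho).
Proof.
move=> rU; split=> /= [|x y /set_mem Hx /set_mem Hy|x Hx|].
- by rewrite !rep1 // map_mx1.
- by rewrite repM // map_mxM.
- by rewrite conjC_unitary rep_unitary.
- by apply: within_conjmx; case: rU.
Qed.

End Reps.

(** * Schur's lemma *)

Section Schur.
Variables (C : numClosedFieldType) (G : topologicalGroupType) (H : set G).
Implicit Types rho sigma tau : rep C G.

(** An invertible intertwiner carries stable subspaces to stable subspaces;
    the equality of the dimensions comes with it. *)
Lemma irreducible_equiv rho sigma :
  equiv_rep H rho sigma -> irreducible_rep H rho -> irreducible_rep H sigma.
Proof.
move=> /equiv_rep_sym [Q [P [QP PQ QE]]] [dim_gt0 irr].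
have PQt : Q^T *m P^T = 1%:M by rewrite -trmx_mul PQ trmx1.
have QPt : P^T *m Q^T = 1%:M by rewrite -trmx_mul QP trmx1.
have QEt x : H x -> (sigma x)^T *m Q^T = Q^T *m (rho x)^T.
  by move=> Hx; rewrite -!trmx_mul QE.
split=> [|U Ustab].
  have := leq_trans (mxrankM_maxl Q P) (rank_leq_col Q).
  by rewrite QP mxrank1; exact: leq_trans.
have [x Hx|/eqP|] := irr <<U *m Q^T>>%MS.
- rewrite (eqmxMr _ (genmxE _)) genmxE -mulmxA -QEt // mulmxA.
  exact: submxMr (Ustab x Hx).
- rewrite -mxrank_eq0 genmxE mxrank_eq0 => /eqP UQ0; left.
  by rewrite -[U]mulmx1 -PQt mulmxA UQ0 mul0mx.
- rewrite /row_full genmxE => /row_fullP[B BE]; right.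
  apply/row_fullP; exists (Q^T *m B).
  have : Q^T *m (B *m (U *m Q^T)) *m P^T = 1%:M by rewrite BE mulmx1.
  by rewrite !mulmxA -[_ *m _ *m P^T]mulmxA PQt mulmx1.
Qed.

(** The kernel and the image of A^T are stable spaces of rows, hence each of
    them is zero or everything. *)
Lemma Schur_lemma rho sigma (A : 'M[C]_(rdim sigma, rdim rho)) :
  irreducible_rep H rho -> irreducible_rep H sigma ->
  (forall x, H x -> A *m rho x = sigma x *m A) ->
  A = 0 \/ equiv_rep H rho sigma.
Proof.
move=> [_ irr_rho] [_ irr_sigma] AE.
have AEt x : H x -> (rho x)^T *m A^T = A^T *m (sigma x)^T.
  by move=> Hx; rewrite -!trmx_mul AE.
have [||/row_fullP[B KB]] := irr_rho (kermx A^T).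
- move=> x Hx; apply/sub_kermxP.
  by rewrite -mulmxA AEt // mulmxA mulmx_ker mul0mx.
- move=> /eqP; rewrite kermx_eq0 => /row_freeP[B AB].
  have [||] := irr_sigma <<A^T>>%MS.
  + move=> x Hx; rewrite (eqmxMr _ (genmxE _)) genmxE -AEt //.
    exact: submxMl.
  + move=> /eqP; rewrite -mxrank_eq0 genmxE mxrank_eq0 => /eqP At0.
    by left; rewrite -[A]trmxK At0 trmx0.
  + rewrite /row_full genmxE => /row_fullP[B' B'A].
    have BB' : B = B' by rewrite -[LHS]mul1mx -B'A -mulmxA AB mulmx1.
    right; exists A, B^T; split=> //.
    * by apply: trmx_inj; rewrite trmx_mul trmxK BB' B'A trmx1.
    * by apply: trmx_inj; rewrite trmx_mul trmxK AB trmx1.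
- left; apply: trmx_inj; rewrite trmx0 -[A^T]mul1mx -KB -mulmxA mulmx_ker.
  by rewrite mulmx0.
Qed.

(** Every eigenspace of A^T is stable, and C is algebraically closed. *)
Lemma Schur_scalar rho (A : 'M[C]_(rdim rho)) :
  irreducible_rep H rho -> (forall x, H x -> A *m rho x = rho x *m A) ->
  exists a, A = a%:M.
Proof.
move=> [dim_gt0 irr] AE; have [a] := eigenvalue_closed A^T dim_gt0.
rewrite /eigenvalue => eig; exists a.
have AEt x : H x -> (rho x)^T *m A^T = A^T *m (rho x)^T.
  by move=> Hx; rewrite -!trmx_mul AE.
have [x Hx||/row_fullP[B KB]] := irr (eigenspace A^T a).
- apply/eigenspaceP; rewrite -mulmxA AEt // mulmxA.
  by rewrite (eigenspaceP (submx_refl _)) -scalemxAl.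
- by move=> eig0; rewrite eig0 eqxx in eig.
- apply: trmx_inj; rewrite tr_scalar_mx -[A^T]mul1mx -KB -mulmxA.
  rewrite (eigenspaceP (submx_refl _)) -scalemxAr KB.
  by rewrite scalemx1.
Qed.
End Schur.

(** * Complete reducibility and the dual *)

Section CompleteReducibility.
Variables (C : numClosedFieldType) (G : topologicalGroupType) (H : set G).
Hypothesis subgroupH : is_subgroup H.
Implicit Types rho sigma tau : rep C G.

(** Orthonormal bases of U and of its orthogonal complement give the two
    blocks; the complement is stable because the adjoint of sigma x is sigma
    x^-1. As the group acts on columns while U is a space of rows, the change
    of basis is the conjugate of the matrix of these bases. *)
Lemma unitary_split sigma (U : 'M[C]_(rdim sigma)) :
  unitary_rep H sigma -> (forall x, H x -> stablemx U (sigma x)^T) ->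
  exists sigma1 sigma2, [/\ unitary_rep H sigma1, unitary_rep H sigma2,
    equiv_rep H sigma (add_rep sigma1 sigma2), rdim sigma1 = \rank U
    & (rdim sigma1 + rdim sigma2)%N = rdim sigma].
Proof.
move=> sU Ustab.
pose S1 := schmidt (row_base U).
pose S2 := schmidt (row_base
  (orthomx Num.conj (mx_of_hermitian (hermitian1mx _)) U)).
have rkU := add_rank_ortho U.
have SU : col_mx S1 S2 \is unitarymx := schmidt_complete_unitarymx U.
pose P := map_mx Num.conj (col_mx S1 S2).
have PU : P \is unitarymx by rewrite conjC_unitary.
have S1U : (S1 :=: U)%MS.
  apply: eqmx_trans (eq_row_base U).
  by apply: eqmx_schmidt_free; rewrite row_base_free.
have S2U : (S2 :=: orthomx Num.conj (mx_of_hermitian (hermitian1mx _)) U)%MS.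
  apply: eqmx_trans (eq_row_base _).
  by apply: eqmx_schmidt_free; rewrite row_base_free.
have off x : H x -> S1 *m (sigma x)^T *m S2^*t = 0.
  move=> Hx; apply/eqP; rewrite -orthomx1E orthomx_sym S2U.
  rewrite submx_ortho (eqmxMr _ S1U).
  exact: Ustab.
have off' x : H x -> S2 *m (sigma x)^T *m S1^*t = 0.
  move=> Hx; have := off _ (subgroupV subgroupH Hx).
  move=> /(congr1 (fun M => M^*t)); rewrite !map_conj_mul tr_conjK.
  rewrite (repV subgroupH sU Hx) trmx0 map_mx0 mulmxA.
  have -> : (((sigma x)^*t)^T)^*t = (sigma x)^T.
    by apply/matrixP => i j; rewrite !mxE conjCK.
  by [].
pose sig m (S : 'M[C]_(m, rdim sigma)) :=
  Rep (fun x => map_mx Num.conj S *m sigma x *m S^T).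
have RE x : H x -> P *m sigma x *m P^*t = block_mx (sig _ S1 x) 0 0 (sig _ S2 x).
  have -> : P^*t = (col_mx S1 S2)^T by apply/matrixP => i j; rewrite !mxE conjCK.
  move=> Hx; rewrite /P map_col_mx tr_col_mx mul_col_mx mul_col_row; congr block_mx.
  - apply: trmx_inj; rewrite trmx0 !trmx_mul trmxK map_trmx mulmxA.
    exact: off'.
  - apply: trmx_inj; rewrite trmx0 !trmx_mul trmxK map_trmx mulmxA.
    exact: off.
have sigU m (S : 'M[C]_(m, rdim sigma)) :
    {within H, continuous (sig m S : G -> 'M_m)}.
  apply: within_mulmx; last exact: within_cst.
  by apply: within_mulmx; [exact: within_cst|case: sU].
(* P has as many rows as columns, but this only holds propositionally *)
have PtP : P^*t *m P = 1%:M.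
  by rewrite -[P^*t]mul1mx mulmxKtV.
have R1 : block_mx (sig _ S1 1%g) 0 0 (sig _ S2 1%g) = 1%:M.
  rewrite -(RE _ (subgroup1 subgroupH)) (rep1 sU) mulmx1.
  exact/unitarymxP.
have RM x y : H x -> H y ->
    block_mx (sig _ S1 (x * y)%g) 0 0 (sig _ S2 (x * y)%g) =
    block_mx (sig _ S1 x *m sig _ S1 y) 0 0 (sig _ S2 x *m sig _ S2 y).
  move=> Hx Hy; rewrite -(RE _ (subgroupM subgroupH Hx Hy)) (repM sU) //.
  have := mulmx_block (sig _ S1 x) 0 0 (sig _ S2 x) (sig _ S1 y) 0 0 (sig _ S2 y).
  rewrite !(mulmx0, mul0mx, addr0, add0r) => <-; rewrite -!RE //.
  by rewrite !mulmxA -[_ *m P^*t *m P]mulmxA PtP mulmx1.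
have RU x : H x ->
    block_mx (sig _ S1 x *m (sig _ S1 x)^*t) 0 0 (sig _ S2 x *m (sig _ S2 x)^*t)
    = 1%:M.
  move=> Hx.
  have := mulmx_block (sig _ S1 x) 0 0 (sig _ S2 x)
    (sig _ S1 x)^*t 0 0 (sig _ S2 x)^*t.
  rewrite !(mulmx0, mul0mx, addr0, add0r) => <-; rewrite -RE //.
  have -> : block_mx (sig _ S1 x)^*t 0 0 (sig _ S2 x)^*t =
      (block_mx (sig _ S1 x) 0 0 (sig _ S2 x))^*t.
    by rewrite tr_block_mx map_block_mx !trmx0 !map_mx0.
  rewrite -RE // !map_conj_mul tr_conjK !mulmxA -[_ *m P^*t *m P]mulmxA PtP mulmx1.
  rewrite -[P *m _ *m _]mulmxA (unitarymxP (rep_unitary sU Hx)) mulmx1.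
  exact/unitarymxP.
exists (sig _ S1), (sig _ S2); split=> //.
- split=> // [|x y /set_mem Hx /set_mem Hy|x Hx].
  + by move: R1; rewrite scalar_mx_block => /eq_block_mx[].
  + by have /eq_block_mx[] := RM x y Hx Hy.
  + by apply/unitarymxP; have := RU x Hx; rewrite scalar_mx_block => /eq_block_mx[].
- split=> // [|x y /set_mem Hx /set_mem Hy|x Hx].
  + by move: R1; rewrite scalar_mx_block => /eq_block_mx[].
  + by have /eq_block_mx[] := RM x y Hx Hy.
  + by apply/unitarymxP; have := RU x Hx; rewrite scalar_mx_block => /eq_block_mx[].
- exists P, P^*t; split=> //; first exact/unitarymxP.
  move=> x Hx; rewrite /= -RE // -[RHS]mulmxA PtP mulmx1 //.
Qed.

Lemma dual_repP (p : dual C H) :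
  unitary_rep H (dual_rep p) /\ irreducible_rep H (dual_rep p).
Proof.
rewrite /dual_rep; case: p => c /=; rewrite inE => -[rho [rU irr ->]].
case: xgetP => [sigma _ [sU rs]|/(_ rho)]; last first.
  by case; split => //; exact: equiv_rep_refl.
by split => //; exact: irreducible_equiv rs irr.
Qed.

Lemma dual_unitary (p : dual C H) : unitary_rep H (dual_rep p).
Proof. by have [] := dual_repP p. Qed.

Lemma dual_irreducible (p : dual C H) : irreducible_rep H (dual_rep p).
Proof. by have [] := dual_repP p. Qed.

(** A class is recovered from any of its elements. *)
Lemma dual_rep_inj (p q : dual C H) :
  equiv_rep H (dual_rep p) (dual_rep q) -> p = q.
Proof.
have classE (r : dual C H) : val r = unitary_class H (dual_rep r).
  rewrite /dual_rep; case: r => c /=; rewrite inE => -[rho [rU irr ->]].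
  case: xgetP => [sigma _ [sU rs]|/(_ rho)]; last first.
    by case; split => //; exact: equiv_rep_refl.
  apply/seteqP; split=> [tau [tU rt]|tau [tU st]]; split => //.
    exact: equiv_rep_trans (equiv_rep_sym rs) rt.
  exact: equiv_rep_trans rs st.
move=> pq; apply: val_inj; rewrite !classE.
apply/seteqP; split=> [tau [tU rt]|tau [tU st]]; split => //.
  exact: equiv_rep_trans (equiv_rep_sym pq) rt.
exact: equiv_rep_trans pq st.
Qed.

Lemma dual_of_irreducible rho : unitary_rep H rho -> irreducible_rep H rho ->
  exists p : dual C H, equiv_rep H rho (dual_rep p).
Proof.
move=> rU irr; have cP : unitary_class H rho \in dual C H.
  by rewrite inE; exists rho.
exists (SigSub cP); rewrite /dual_rep /=.
case: xgetP => [sigma _ [sU rs]//|/(_ rho)].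
by case; split => //; exact: equiv_rep_refl.
Qed.

Lemma Ch_triv_dual x : H x -> Ch (dual_rep (triv_dual C H)) x = 1.
Proof.
move=> Hx; rewrite -(Ch_triv C x); apply/esym/(Ch_equiv (H := H)) => //.
rewrite /dual_rep; case: xgetP => [sigma _ [_]//|/(_ (triv_rep C G))].
by case; split; [exact: unitary_triv|exact: equiv_rep_refl].
Qed.

Lemma equiv_sum_cat (s1 s2 : seq (rep C G)) :
  equiv_rep H (add_rep (sum_rep s1) (sum_rep s2)) (sum_rep (s1 ++ s2)).
Proof.
elim: s1 => [|r s IH] /=; first exact: equiv_add0.
apply: equiv_rep_trans (equiv_rep_sym (equiv_addA _ _ _ _)) _.
by apply: equiv_add IH; exact: equiv_rep_refl.
Qed.

Lemma equiv_add0r rho : equiv_rep H rho (add_rep rho (zero_rep C G)).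
Proof.
exists (col_mx 1%:M 0), (row_mx 1%:M 0); split=> [||x Hx] /=.
- rewrite mul_col_row !(mulmx0, mul0mx, mulmx1) scalar_mx_block.
  by congr block_mx; apply/matrixP => -[].
- by rewrite mul_row_col mulmx0 mulmx1 addr0.
- rewrite mul_col_mx mul_block_col.
  by rewrite !(mul1mx, mulmx1, mulmx0, mul0mx, addr0).
Qed.

(** Split off a stable subspace as long as there is one; the dimension
    decreases. *)
Lemma complete_reducibility sigma : unitary_rep H sigma ->
  exists s : seq (dual C H), equiv_rep H sigma (sum_rep [seq dual_rep p | p <- s]).
Proof.
have [n] := ubnP (rdim sigma); elim: n sigma => // n IH sigma ltn sU.
have [d0|d_gt0] := posnP (rdim sigma).
  exists [::]; case: sigma d0 {ltn sU} => m f /= m0; subst m.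
  exists 0, 0; split=> [||x Hx]; by apply/matrixP => -[].
have [irr|nirr] := pselect (irreducible_rep H sigma).
  have [p pE] := dual_of_irreducible sU irr; exists [:: p].
  exact: equiv_rep_trans pE (equiv_add0r _).
have [U [Ustab U0 Ufull]] : exists U : 'M[C]_(rdim sigma),
    [/\ forall x, H x -> stablemx U (sigma x)^T, U != 0 & ~~ row_full U].
  apply: contrapT => no; apply: nirr; split=> // U Ustab.
  have [->|U0] := eqVneq U 0; first by left.
  by right; apply: contrapT => /negP nf; apply: no; exists U.
have [s1 [s2 [s1U s2U sE d1 d12]]] := unitary_split sU Ustab.
have rk_gt0 : (0 < \rank U)%N by rewrite lt0n mxrank_eq0.
have rk_lt : (\rank U < rdim sigma)%N by rewrite ltn_neqAle Ufull rank_leq_col.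
have [|t1 t1E] := IH s1 _ s1U; first by rewrite d1 (leq_trans rk_lt).
have [|t2 t2E] := IH s2 _ s2U.
  rewrite -(ltn_add2l (rdim s1)) d12 (leq_trans ltn) // d1.
  by rewrite -[X in (X <= _)%N]add1n leq_add2r.
exists (t1 ++ t2); rewrite map_cat.
apply: equiv_rep_trans sE _.
exact: equiv_rep_trans (equiv_add t1E t2E) (equiv_sum_cat _ _).
Qed.

Lemma constituentsP sigma : unitary_rep H sigma ->
  equiv_rep H sigma (sum_rep [seq dual_rep p | p <- constituents H sigma]).
Proof.
move=> /complete_reducibility [s sE]; rewrite /constituents.
by case: xgetP => [t _ //|/(_ s)]; case.
Qed.

Lemma Ch_constituents sigma x : unitary_rep H sigma -> H x ->
  Ch sigma x = \sum_(p <- constituents H sigma) Ch (dual_rep p) x.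
Proof.
move=> sU Hx; rewrite (Ch_equiv (constituentsP sU) Hx) Ch_sum.
by rewrite big_map.
Qed.

End CompleteReducibility.

(** * Invariant averages *)

Section Means.
Variables (C : numClosedFieldType) (G : topologicalGroupType) (H : set G).
Hypothesis subgroupH : is_subgroup H.
Implicit Types (rho sigma tau : rep C G) (m : seq (C * G)).

(** The list m stands for the finitely supported measure with mass p.1 at p.2,
    and average m f for the integral of f. Invariant measures being out of
    reach with finite support, invariance is only asked against given
    representations. *)
Definition average m (f : G -> C) : C := \sum_(p <- m) p.1 * f p.2.

Definition average_mx m sigma : 'M[C]_(rdim sigma) :=
  \sum_(p <- m) p.1 *: sigma p.2.

Definition affine_weights m : Prop :=
  {in m, forall p, H p.2} /\ \sum_(p <- m) p.1 = 1.

(** Total mass 1 and left invariance make average_mx m sigma a projection onto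
    the invariant vectors, as integration against the Haar measure of H would.
    *)
Definition invariant_average m sigma : Prop :=
  affine_weights m /\
  forall x, H x -> sigma x *m average_mx m sigma = average_mx m sigma.

Lemma mxtrace_average m sigma : \tr (average_mx m sigma) = average m (Ch sigma).
Proof. by rewrite linear_sum; apply: eq_bigr => p _; rewrite linearZ. Qed.

Lemma average_ext m f g : {in m, forall p, H p.2} ->
  (forall x, H x -> f x = g x) -> average m f = average m g.
Proof. by move=> mH fg; apply: eq_big_seq => p /mH/fg->. Qed.

Lemma averageZ m k f : average m (fun x => k * f x) = k * average m f.
Proof. by rewrite mulr_sumr; apply: eq_bigr => p _; rewrite mulrCA. Qed.

Lemma average_sum m (I : Type) (s : seq I) (F : I -> G -> C) :
  average m (fun x => \sum_(i <- s) F i x) = \sum_(i <- s) average m (F i).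
Proof.
rewrite exchange_big; apply: eq_bigr => p _.
by rewrite mulr_sumr.
Qed.

Lemma average_add m rho sigma :
  average_mx m (add_rep rho sigma) =
  block_mx (average_mx m rho) 0 0 (average_mx m sigma).
Proof.
rewrite /average_mx; elim: m => [|p m IH].
  by rewrite !big_nil; apply/esym/block_mx0.
by rewrite !big_cons IH /= scale_block_mx add_block_mx !scaler0 !addr0.
Qed.

Lemma invariant_average_add m rho sigma :
  invariant_average m (add_rep rho sigma) ->
  invariant_average m rho /\ invariant_average m sigma.
Proof.
move=> [mP inv]; split; split=> // x Hx; have := inv x Hx;
by rewrite average_add mulmx_block
  !(mulmx0, mul0mx, addr0, add0r) => /eq_block_mx[].
Qed.

Lemma invariant_average_sum m (s : seq (rep C G)) :
  invariant_average m (sum_rep s) -> {in s, forall r, invariant_average m r}.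
Proof.
elim: s => [//|r s IH] /invariant_average_add[inv_r /IH inv_s] t.
by rewrite inE => /predU1P[->|/inv_s].
Qed.

Lemma average_fix m sigma p (v : 'M[C]_(rdim sigma, p)) : affine_weights m ->
  (forall x, H x -> sigma x *m v = v) -> average_mx m sigma *m v = v.
Proof.
move=> [mH m1] vE; rewrite mulmx_suml -[RHS]scale1r -m1 scaler_suml.
by apply: eq_big_seq => q /mH Hq; rewrite -scalemxAl vE.
Qed.

(** Let I be the span of the sigma h - 1, a two-sided ideal, stable under
    adjoint, of the span of the sigma h. Write 1 = E + J with J in I and E
    orthogonal to I. Then E is an affine combination of the sigma h, and
    (sigma x - 1) E lies in I and is orthogonal to I, hence vanishes. *)
Lemma exists_invariant_average1 sigma : unitary_rep H sigma ->
  exists m, invariant_average m sigma.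
Proof.
move=> sU; pose v (h : G) := mxvec (sigma h - 1%:M).
have [hs [hsH hs_span]] := finite_span H v.
set U := (\sum_(h <- hs) <<v h>>)%MS in hs_span.
(* J is the projection of the identity matrix onto the span U of the
   sigma h - 1, and the average of m is E = 1 - J. *)
pose j := mxvec 1%:M *m proj_ortho U.
have /sub_span[mj [mjE jE]] : (j <= U)%MS by exact: proj_ortho_sub.
have mjH : {in mj, forall p, H p.2}.
  by move=> p pm; apply: hsH; rewrite -mjE; apply: map_f.
pose m := (1 + \sum_(p <- mj) p.1, 1%g) :: [seq (- p.1, p.2) | p <- mj].
have mH : {in m, forall p, H p.2}.
  move=> p; rewrite inE => /predU1P[->|/mapP[q /mjH Hq ->]//].
  exact: (subgroup1 subgroupH).
have m1 : \sum_(p <- m) p.1 = 1.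
  by rewrite big_cons big_map /= sumrN -addrA subrr addr0.
pose E := average_mx m sigma.
have EE : mxvec E = mxvec 1%:M - j.
  rewrite jE -[LHS]addr0 /E /average_mx big_cons big_map /= (rep1 sU).
  rewrite scalerDl scale1r scaler_suml !addr0 -addrA -big_split /=.
  rewrite linearD linear_sum /=; congr (_ + _); rewrite -sumrN.
  apply: eq_bigr => p _; rewrite /v -linearZ -linearN; congr (mxvec _).
  by rewrite scaleNr scalerBr opprB.
have orth y : H y -> hsdot E (sigma y - 1%:M) = 0.
  move=> Hy; have /orthomx1P EU : (mxvec E <= orthomx Num.conj
      (mx_of_hermitian (hermitian1mx _)) U)%MS.
    by rewrite EE proj_ortho_compl_sub.
  have /submxP[D vE] := hs_span y Hy.
  rewrite -hsdot_mxvec -/(v y) vE map_conj_mul mulmxA.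
  by rewrite EU mul0mx mxE.
exists m; split=> // x Hx; apply/eqP; rewrite -subr_eq0; apply/eqP.
set Y := _ - _.
have YE : Y = (sigma x - 1%:M) *m E by rewrite mulmxBl mul1mx.
have orthY y : H y -> hsdot Y (sigma y - 1%:M) = 0.
  move=> Hy; rewrite YE hsdot_mull.
  have -> : (sigma x - 1%:M)^*t = sigma x^-1%g - 1%:M.
    by rewrite (repV subgroupH sU Hx) linearB /= raddfB /= trmx1 map_mx1.
  have -> : (sigma x^-1%g - 1%:M) *m (sigma y - 1%:M) =
      (sigma (x^-1 * y)%g - 1%:M) - (sigma x^-1%g - 1%:M) - (sigma y - 1%:M).
    rewrite (repM sU) //; last exact: (subgroupV subgroupH).
    rewrite mulmxBl !mulmxBr !mulmx1 !mul1mx.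
    move: (sigma x^-1%g) (sigma y) (sigma x^-1%g *m sigma y) => A B M.
    by apply/matrixP => a b; rewrite !mxE; ring.
  have HxV := subgroupV subgroupH Hx.
  rewrite hsdotDr hsdotNr (orth y) // subr0.
  rewrite hsdotDr hsdotNr (orth _ HxV) subr0.
  exact: orth (subgroupM subgroupH HxV Hy).
apply: hsdot_eq0; rewrite {2}/Y -/E.
have -> : sigma x *m E - E =
    \sum_(p <- m) p.1 *: ((sigma (x * p.2)%g - 1%:M) - (sigma p.2 - 1%:M)).
  rewrite /E /average_mx mulmx_sumr -sumrB; apply: eq_big_seq => p /mH Hp.
  by rewrite (repM sU) // -scalemxAr opprB addrA subrK scalerBr.
rewrite hsdot_sumr big1_seq // => p /= /mH Hp.
rewrite hsdotZr hsdotDr hsdotNr !orthY ?subr0 ?mulr0 //.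
exact: (subgroupM subgroupH).
Qed.

(** An invariant average for the direct sum is one for each summand. *)
Lemma exists_invariant_average (s : seq (rep C G)) :
  {in s, forall r, unitary_rep H r} ->
  exists m, affine_weights m /\ {in s, forall r, invariant_average m r}.
Proof.
move=> /unitary_sum/exists_invariant_average1[m mP].
by exists m; split; [case: mP|exact: invariant_average_sum].
Qed.

Section TwoSided.
Variables (m : seq (C * G)) (sigma : rep C G).
Hypotheses (sU : unitary_rep H sigma) (mP : invariant_average m sigma).
Let E := average_mx m sigma.

Lemma average_idem : E *m E = E.
Proof. by case: mP => mw inv; apply: average_fix. Qed.

(** The adjoint of E is a combination, of total mass 1, of the sigma h^-1,
    each of which fixes E; hence E^* E = E. *)
Lemma average_selfadjoint : E^*t = E.
Proof.
case: mP => -[mH m1] inv.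
have EtE : E^*t *m E = E.
  have -> : E^*t = \sum_(p <- m) (p.1)^* *: sigma p.2^-1%g.
    rewrite /E /average_mx linear_sum raddf_sum; apply: eq_big_seq => p /mH Hp.
    by rewrite linearZ /= map_mxZ (repV subgroupH sU).
  rewrite mulmx_suml -[RHS]scale1r -(rmorph1 Num.conj) -m1 rmorph_sum scaler_suml.
  apply: eq_big_seq => p /mH Hp; rewrite -scalemxAl inv //.
  exact: (subgroupV subgroupH).
by rewrite -EtE map_conj_mul tr_conjK.
Qed.

Lemma average_invr x : H x -> E *m sigma x = E.
Proof.
case: mP => -[mH m1] inv Hx.
have := inv _ (subgroupV subgroupH Hx) => /(congr1 (fun M => M^*t)).
by rewrite map_conj_mul -/E average_selfadjoint (repV subgroupH sU) // tr_conjK.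
Qed.

End TwoSided.

End Means.

(** * Orthogonality of irreducible characters *)

Section Orthogonality.
Variables (C : numClosedFieldType) (G : topologicalGroupType) (H : set G).
Hypothesis subgroupH : is_subgroup H.
Implicit Types (rho sigma tau : rep C G) (m : seq (C * G)).

Lemma sum_tens_index n n' (F : 'I_(n * n') -> C) :
  \sum_k F k = \sum_i \sum_j F (mxtens_index (i, j)).
Proof.
rewrite pair_bigA (reindex (@mxtens_index n n')) /=.
  by apply: eq_bigr => -[i j].
by exists (@mxtens_unindex n n') => k _;
  [exact: mxtens_indexK|exact: mxtens_unindexK].
Qed.

Section TensorBlocks.
Variables (rho sigma : rep C G) (m : seq (C * G)).
Hypotheses (rU : unitary_rep H rho) (sU : unitary_rep H sigma).
Hypothesis mP : invariant_average H m (tens_rep (conj_rep rho) sigma).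
Let T : 'M[C]_(rdim rho * rdim sigma) :=
  average_mx m (tens_rep (conj_rep rho) sigma).

(** The tensor product of the conjugate of rho with sigma acts on matrices X
    by sigma x X (rho x)^*. The column of T with index (l, k), reshaped as
    such a matrix, is the average of the orbit of an elementary matrix, hence
    an intertwiner. *)
Definition tensor_column l k : 'M[C]_(rdim sigma, rdim rho) :=
  \matrix_(i, j) T (mxtens_index (j, i)) (mxtens_index (l, k)).

Lemma tensor_column_intertwines l k x : H x ->
  tensor_column l k *m rho x = sigma x *m tensor_column l k.
Proof.
move=> Hx; case: mP => _ /(_ x Hx) inv.
have sr : sigma x *m tensor_column l k *m (rho x)^*t = tensor_column l k.
  apply/matrixP => i j; rewrite [RHS]mxE -[T in RHS]inv.
  rewrite [LHS]mxE [RHS]mxE sum_tens_index; apply: eq_bigr => b _.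
  rewrite [in LHS]mxE mulr_suml; apply: eq_bigr => a _.
  rewrite tensmxE !mxE; ring.
have /unitarymxP/mulmx1C rr := rep_unitary rU Hx.
by rewrite -[in LHS]sr -mulmxA rr mulmx1.
Qed.

Lemma mxtrace_tensor_columns :
  \tr T = \sum_j \sum_i tensor_column j i i j.
Proof.
rewrite /mxtrace sum_tens_index; apply: eq_bigr => j _.
by apply: eq_bigr => i _; rewrite mxE.
Qed.

End TensorBlocks.
Arguments tensor_column rho sigma m l k : clear implicits.

(** The action X -> rho x X (rho x)^* preserves the trace, so the average of
    an elementary matrix has the trace of that matrix. *)
Lemma tensor_column_trace rho m l k : unitary_rep H rho ->
  invariant_average H m (tens_rep (conj_rep rho) rho) ->
  \tr (tensor_column rho rho m l k) = (l == k)%:R.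
Proof.
move=> rU [[mH m1] _]; rewrite /mxtrace.
under eq_bigr do rewrite mxE /average_mx summxE.
rewrite exchange_big /= -[RHS]mul1r -[X in _ = X * _]m1 mulr_suml.
apply: eq_big_seq => p /mH Hp.
under eq_bigr do rewrite mxE tensmxE mxE.
rewrite -mulr_sumr; congr (_ * _).
have /unitarymxP/mulmx1C/matrixP/(_ l k) := rep_unitary rU Hp.
rewrite !mxE => E. rewrite -E.
by apply: eq_bigr => i _; rewrite !mxE.
Qed.

(** The mean value is a sum of entries of the tensor columns. By Schur's lemma
    these intertwiners vanish if p and q differ; otherwise they are scalar
    matrices, determined by their traces. *)
Lemma character_orthogonality (p q : dual C H) m :
  invariant_average H m (tens_rep (conj_rep (dual_rep p)) (dual_rep q)) ->
  average m (Ch (tens_rep (conj_rep (dual_rep p)) (dual_rep q))) = (p == q)%:R.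
Proof.
move=> mP; rewrite -mxtrace_average.
have := mxtrace_tensor_columns (dual_rep p) (dual_rep q) m.
move=> ->.
have [pq|npq] := eqVneq p q; last first.
  rewrite big1 // => j _; rewrite big1 // => i _.
  have [x Hx|->|/dual_rep_inj pq] := @Schur_lemma _ _ H _ _
      (tensor_column (dual_rep p) (dual_rep q) m j i)
      (dual_irreducible p) (dual_irreducible q).
  - exact: (tensor_column_intertwines (dual_unitary p)).
  - by rewrite mxE.
  - by rewrite pq eqxx in npq.
subst q; set rho := dual_rep p in mP *.
have rU : unitary_rep H rho := dual_unitary p.
have irr : irreducible_rep H rho := dual_irreducible p.
have n0 : (rdim rho)%:R != 0 :> C by rewrite pnatr_eq0 -lt0n; case: irr.
have colE l k : tensor_column rho rho m l k = ((l == k)%:R / (rdim rho)%:R)%:M.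
  have [|a aE] := @Schur_scalar _ _ H _ (tensor_column rho rho m l k) irr.
    by move=> x Hx; exact: (tensor_column_intertwines rU).
  have := tensor_column_trace l k rU mP.
  rewrite aE mxtrace_scalar => <-; congr (_%:M).
  by rewrite -[a *+ _]mulr_natr mulfK.
under eq_bigr => j _ do under eq_bigr => i _ do rewrite colE mxE.
under eq_bigr => j _.
  rewrite (bigD1 j) //= eqxx big1 ?addr0; last first.
    by move=> i /negPf ij; rewrite ij.
  over.
by rewrite sumr_const card_ord mulr1n mul1r -[LHS]mulr_natl mulfV.
Qed.

End Orthogonality.

(** * Formal sums and their characters *)

Section FormalSums.
Variables (C : numClosedFieldType) (F : choiceType).
Local Notation CF := {formal C[F]}.

Section Linear.
Variables (V : lmodType C) (phi : C -> C) (f : F -> C -> V).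
Hypothesis f0 : forall x, f x 0 = 0.
Hypothesis fD : forall x k u v, f x (k * u + v) = phi k *: f x u + f x v.

Lemma fsupp_sum_widen (d : {fset F}) (a : CF) : (fsupp a `<=` d)%fset ->
  \sum_(x <- fsupp a) f x (fcoef x a) = \sum_(x <- d) f x (fcoef x a).
Proof.
move=> ad; apply: big_fset_incl => // x _ xa.
by rewrite mcoeff_outdom // f0.
Qed.

(** Taking phi to be the identity or the complex conjugation covers both the
    bilinear and the conjugate-linear extensions. *)
Lemma fsupp_sum_linear k (a b : CF) :
  \sum_(x <- fsupp (k *: a + b)) f x (fcoef x (k *: a + b)) =
  phi k *: (\sum_(x <- fsupp a) f x (fcoef x a)) +
  \sum_(x <- fsupp b) f x (fcoef x b).
Proof.
pose d := (fsupp (k *: a + b) `|` fsupp a `|` fsupp b)%fset.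
have [ud [ad bd]] : (fsupp (k *: a + b)%R `<=` d)%fset /\
    (fsupp a `<=` d)%fset /\ (fsupp b `<=` d)%fset.
  by repeat split; apply/fsubsetP => x xs; rewrite !in_fsetU xs ?orbT.
rewrite !(@fsupp_sum_widen d) //.
rewrite scaler_sumr -big_split; apply: eq_bigr => x _ /=.
by rewrite mcoeffD mcoeffZ fD.
Qed.

End Linear.

Lemma fsupp_sum_basis (V : lmodType C) (f : F -> C -> V) (y : F) :
  \sum_(x <- fsupp (fbasis y : CF)) f x (fcoef x (fbasis y : CF)) = f y 1.
Proof. by rewrite msuppU oner_eq0 big_seq_fset1 mcoeffUU. Qed.

Lemma bilinear_extE (m : F -> F -> CF) (a b : CF) : bilinear_ext m a b =
  \sum_(x <- fsupp a) fcoef x a *: \sum_(y <- fsupp b) fcoef y b *: m x y.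
Proof.
apply: eq_bigr => x _; rewrite scaler_sumr; apply: eq_bigr => y _.
by rewrite scalerA.
Qed.

Lemma bilinear_ext_linearr (m : F -> F -> CF) k (a b c : CF) :
  bilinear_ext m a (k *: b + c) = k *: bilinear_ext m a b + bilinear_ext m a c.
Proof.
rewrite !bilinear_extE scaler_sumr -big_split; apply: eq_bigr => x _ /=.
rewrite (@fsupp_sum_linear _ id (fun y t => t *: m x y)).
- by rewrite scalerDr !scalerA mulrC.
- by move=> y; rewrite scale0r.
- by move=> y l u v; rewrite scalerDl scalerA.
Qed.

Lemma bilinear_ext_linearl (m : F -> F -> CF) k (a b c : CF) :
  bilinear_ext m (k *: a + b) c = k *: bilinear_ext m a c + bilinear_ext m b c.
Proof.
rewrite !bilinear_extE.
rewrite (@fsupp_sum_linear _ id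
  (fun x t => t *: \sum_(y <- fsupp c) fcoef y c *: m x y)) //.
- by move=> y; rewrite scale0r.
- by move=> y l u v; rewrite scalerDl scalerA.
Qed.

Lemma bilinear_ext_basis (m : F -> F -> CF) (x y : F) :
  bilinear_ext m (fbasis x) (fbasis y) = m x y.
Proof.
rewrite bilinear_extE.
rewrite (fsupp_sum_basis (fun x t =>
  t *: \sum_(z <- fsupp (fbasis y : CF)) fcoef z (fbasis y : CF) *: m x z)).
by rewrite (fsupp_sum_basis (fun z t => t *: m x z)) !scale1r.
Qed.

Lemma conj_linear_ext_linear (s : F -> CF) k (a b : CF) :
  conj_linear_ext s (k *: a + b) = k^* *: conj_linear_ext s a + conj_linear_ext s b.
Proof.
apply: (@fsupp_sum_linear _ Num.conj (fun x t => t^* *: s x)).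
- by move=> y; rewrite rmorph0 scale0r.
- by move=> y l u v; rewrite rmorphD rmorphM scalerDl scalerA.
Qed.

Lemma conj_linear_ext_basis (s : F -> CF) (x : F) :
  conj_linear_ext s (fbasis x) = s x.
Proof.
rewrite /conj_linear_ext (fsupp_sum_basis (fun x t => t^* *: s x)).
by rewrite rmorph1 scale1r.
Qed.

End FormalSums.

Section Fourier.
Variables (C : numClosedFieldType) (G : topologicalGroupType) (H : set G).
Hypothesis subgroupH : is_subgroup H.
Variables (F : choiceType) (inj : dual C H -> F) (proj : F -> option (dual C H)).
Hypothesis projE : forall x p, proj x = Some p <-> x = inj p.
Local Notation CF := {formal C[F]}.

(** The symbols of one colour are those in the image of inj; proj recognises
    them, and the symbols of the other colour contribute zero. *)
Definition char_sum (a : CF) (x : G) : C :=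
  \sum_(s <- fsupp a) fcoef s a * oapp (fun p => Ch (dual_rep p) x) 0 (proj s).

Lemma char_sum_linear k (a b : CF) x :
  char_sum (k *: a + b) x = k * char_sum a x + char_sum b x.
Proof.
apply: (@fsupp_sum_linear C F C^o id
  (fun s t => t * oapp (fun p => Ch (dual_rep p) x) 0 (proj s))).
- by move=> y; rewrite mul0r.
- by move=> y l u v; rewrite mulrDl -mulrA.
Qed.

Lemma char_sum0 x : char_sum 0 x = 0.
Proof. by rewrite /char_sum msupp0 big_seq_fset0. Qed.

Lemma char_sumD (a b : CF) x : char_sum (a + b) x = char_sum a x + char_sum b x.
Proof. by rewrite -[a]scale1r char_sum_linear mul1r scale1r. Qed.

Lemma char_sum_sum I (s : seq I) (f : I -> CF) x :
  char_sum (\sum_(i <- s) f i) x = \sum_(i <- s) char_sum (f i) x.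
Proof.
elim: s => [|i s IH]; first by rewrite !big_nil char_sum0.
by rewrite !big_cons char_sumD IH.
Qed.

Lemma char_sum_basis s x :
  char_sum (fbasis s) x = oapp (fun p => Ch (dual_rep p) x) 0 (proj s).
Proof.
rewrite /char_sum (@fsupp_sum_basis C F C^o
  (fun s t => t * oapp (fun p => Ch (dual_rep p) x) 0 (proj s))).
exact: mul1r.
Qed.

(** The representations for which an average must be invariant in order to
    compute the coefficient of inj p in a. *)
Definition coef_reps (p : dual C H) (a : CF) : seq (rep C G) :=
  [seq tens_rep (conj_rep (dual_rep p)) (dual_rep q) | q <- pmap proj (fsupp a)].

Lemma coef_reps_unitary p a : {in coef_reps p a, forall r, unitary_rep H r}.
Proof.
move=> r /mapP[q _ ->].
by apply: unitary_tens (unitary_conj (dual_unitary p)) (dual_unitary q).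
Qed.

(** Orthogonality of characters extracts the coefficient. *)
Lemma average_coef p (a : CF) m : affine_weights H m ->
  {in coef_reps p a, forall r, invariant_average H m r} ->
  average m (fun x => (Ch (dual_rep p) x)^* * char_sum a x) = fcoef (inj p) a.
Proof.
move=> mw mP.
transitivity (\sum_(s <- fsupp a) fcoef s a * (s == inj p)%:R).
  rewrite (_ : average _ _ = average m (fun x => \sum_(s <- fsupp a) fcoef s a *
     ((Ch (dual_rep p) x)^* * oapp (fun p => Ch (dual_rep p) x) 0 (proj s)))); last first.
    apply: eq_bigr => -[c h] _ /=; congr (_ * _); rewrite mulr_sumr.
    by apply: eq_bigr => s _; rewrite mulrCA.
  rewrite average_sum; apply: eq_big_seq => s sa; rewrite averageZ; congr (_ * _).
  case E: (proj s) => [q|] /=.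
    have := E => /projE ->.
    have -> : (inj q == inj p) = (p == q).
      apply/idP/idP => [/eqP/projE|/eqP->//].
      have /projE -> : inj q = inj q by [].
      by move=> [->].
    rewrite -(character_orthogonality (m := m)).
      by apply: eq_bigr => -[c h] _; rewrite Ch_tens Ch_conj.
    by apply: mP; apply: map_f; rewrite mem_pmap -E; exact: map_f.
  rewrite (_ : s == _ = false).
    by rewrite /average big1 // => -[c h] _; rewrite !mulr0.
  by apply/negbTE/eqP => /projE; rewrite E.
rewrite [in RHS](monalgE a) raddf_sum; apply: eq_bigr => s _.
by rewrite /= mcoeffU mulr_natr.
Qed.

(** Linear independence of irreducible characters: one average serves for both
    sums. *)
Lemma char_sum_inj (a b : CF) : (forall x, H x -> char_sum a x = char_sum b x) ->
  forall p, fcoef (inj p) a = fcoef (inj p) b.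
Proof.
move=> ab p.
have [|m [mw mP]] := @exists_invariant_average _ _ _ subgroupH
    (coef_reps p a ++ coef_reps p b).
  by move=> r; rewrite mem_cat => /orP[]; exact: coef_reps_unitary.
rewrite -(average_coef mw (a := a)); last first.
  by move=> r ra; apply: mP; rewrite mem_cat ra.
rewrite -(average_coef mw (a := b)); last first.
  by move=> r rb; apply: mP; rewrite mem_cat rb orbT.
have [mH _] := mw.
by apply: (average_ext mH) => x Hx; rewrite ab.
Qed.

End Fourier.

(** * Left transversals of a subgroup of finite index *)

Section Induction.
Variables (G : topologicalGroupType) (H : set G).
Hypotheses (subgroupH : is_subgroup H) (finite_indexH : finite_set (left_cosets H)).

Local Notation t := (tnth (in_tuple (left_transversal H))).

Lemma mem_iff (x : G) : (x \in H) <-> H x.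
Proof. by rewrite inE. Qed.

(** Choosing an element in each of the finitely many left cosets gives a list
    with this property, so the arbitrary one chosen by left_transversal has it
    as well. *)
Lemma left_transversal_count (x : G) :
  count (fun t => t^-1 * x \in H)%g (left_transversal H) = 1%N.
Proof.
pose coset (y : G) := [set (y * h)%g | h in H].
have cosetP y z : (coset y == coset z) = (y^-1 * z \in H)%g.
  apply/eqP/idP => [yz|].
    have : coset z z by exists 1%g; [exact: subgroup1|rewrite mulg1].
    by rewrite -yz inE => -[h Hh <-]; rewrite mulKg.
  rewrite inE => Hyz; apply/seteqP; split=> w [h Hh <-].
    exists ((y^-1 * z)^-1 * h)%g.
      exact: (subgroupM subgroupH (subgroupV subgroupH Hyz)).
    by rewrite invgM invgK !mulgA mulgV mul1g.
  exists ((y^-1 * z) * h)%g; first exact: (subgroupM subgroupH).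
  by rewrite !mulgA mulgV mul1g.
have /finite_seqP[s sE] := finite_indexH.
pose r (c : set G) := xget 1%g [set y | c = coset y].
have rP c : c \in s -> coset (r c) = c.
  move=> cs; have : left_cosets H c by rewrite sE.
  move=> [y _ yc]; rewrite /r; case: xgetP => [z _ /= -> //|/(_ y)].
  by rewrite /= -yc.
rewrite /left_transversal.
case: xgetP => [s' _ /(_ x)//|/(_ [seq r c | c <- undup s])].
case=> y; rewrite count_map.
have ys : coset y \in undup s.
  have : left_cosets H (coset y) by exists y.
  by rewrite sE /= mem_undup.
transitivity (nat_of_bool (coset y \in undup s)); last by rewrite ys.
rewrite -count_uniq_mem ?undup_uniq //.
apply: eq_in_count => c; rewrite mem_undup => cs.
by rewrite /= -cosetP rP // eq_sym.
Qed.

Lemma transversal_index (x : G) :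
  exists i, H ((t i)^-1 * x)%g /\ forall j, H ((t j)^-1 * x)%g -> j = i.
Proof.
have := left_transversal_count x; rewrite -sum1_count big_tnth big_mkcond /=.
move=> /eqP/sum_nat_eq1[i [_ Hi Hj]]; exists i; split.
  by apply/mem_iff; move: Hi; case: ifP.
move=> j /mem_iff Hjx; apply/eqP/negPn/negP => ji.
by have := Hj j ji isT; rewrite Hjx.
Qed.

(** Left multiplication by x permutes the left cosets. *)
Lemma transversal_col (x : G) k :
  exists j, forall i, ((t i)^-1 * x * t k \in H)%g = (i == j).
Proof.
have [j [Hj Uj]] := transversal_index (x * t k)%g; exists j => i.
apply/idP/eqP => [/mem_iff|->].
  by rewrite -mulgA => /Uj.
by apply/mem_iff; rewrite -mulgA.
Qed.

Lemma transversal_row (x : G) i :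
  exists k, forall j, ((t i)^-1 * x * t j \in H)%g = (j == k).
Proof.
have [k kP] := transversal_col x^-1%g i; exists k => j; rewrite -kP.
have invE : ((t i)^-1 * x * t j = ((t j)^-1 * x^-1 * t i)^-1)%g.
  by rewrite !invgM !invgK !mulgA.
by apply/idP/idP => /mem_iff; rewrite invE => /(subgroupV subgroupH);
  rewrite ?invgK => /mem_iff.
Qed.

Lemma transversal_diag i j : ((t i)^-1 * t j \in H)%g = (i == j).
Proof.
have [k kP] := transversal_col 1%g j; have := kP j; rewrite mulg1 mulVg.
have -> : (1%g \in H) = true by apply/mem_iff; exact: subgroup1.
by move=> /esym/eqP jk; have := kP i; rewrite mulg1 -jk.
Qed.

(** The complement is the union of the finitely many translates t_i H, with
    t_i outside H, of the closed set H. *)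
Lemma subgroup_open : closed H -> open H.
Proof.
move=> closedH; rewrite openE => x Hx; rewrite /interior.
have near_out i : \forall y \near x, ~ H (t i) -> ~ H ((t i)^-1 * y)%g.
  have [Hti|nHti] := pselect (H (t i)); first by apply: nearW => y /(_ Hti).
  have nHx : (~` H) ((t i)^-1 * x)%g.
    move=> /(subgroupV subgroupH); rewrite invgM invgK => Hxt; apply: nHti.
    by rewrite -[t i]mul1g -(mulgV x) -mulgA; exact: (subgroupM subgroupH).
  have cont : (fun y => (t i)^-1 * y)%g @ x --> ((t i)^-1 * x)%g.
    apply: (@continuous_comp _ _ _ (fun y : G => ((t i)^-1%g, y))
      (fun z : G * G => (z.1 * z.2)%g) x).
      by apply: cvg_pair; [exact: cvg_cst|exact: cvg_id].
    exact: mulg_continuous.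
  have nbH : nbhs ((t i)^-1 * x)%g (~` H).
    by apply: open_nbhs_nbhs; split=> //; exact: closed_openC.
  have nbx : nbhs x (fun y => ~ H ((t i)^-1 * y)%g) := cont _ nbH.
  by apply: filterS nbx => y nHy _.
have /filter_forall := near_out; apply: filterS => y out.
have [i [Hi _]] := transversal_index y.
have [Hti|nHti] := pselect (H (t i)); last by have := out i nHti.
by rewrite -[y](mulVKg (t i)); exact: (subgroupM subgroupH).
Qed.

Lemma conj_transl_continuous (a b : G) : continuous (fun x => a * x * b)%g.
Proof.
move=> x.
apply: (@continuous_comp _ _ _ (fun y : G => ((a * y)%g, b))
  (fun z : G * G => (z.1 * z.2)%g) x).
  apply: cvg_pair; last exact: cvg_cst.
  apply: (@continuous_comp _ _ _ (fun y : G => (a, y))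
    (fun z : G * G => (z.1 * z.2)%g) x).
    by apply: cvg_pair; [exact: cvg_cst|exact: cvg_id].
  exact: mulg_continuous.
exact: mulg_continuous.
Qed.

End Induction.

(** * Induced representations and Frobenius reciprocity *)

Section InducedRep.
Variables (C : numClosedFieldType) (G : topologicalGroupType) (H : set G).
Hypotheses (subgroupH : is_subgroup H) (finite_indexH : finite_set (left_cosets H)).
Implicit Types rho : rep C G.

Local Notation t := (tnth (in_tuple (left_transversal H))).

(** The formula of Frobenius for the character of an induced representation.
    *)
Definition induced_function (k : G -> C) (x : G) : C :=
  \sum_(t <- left_transversal H)
    if (t^-1 * x * t)%g \in H then k (t^-1 * x * t)%g else 0.

Lemma Ch_ind rho x : Ch (ind_rep H rho) x = induced_function (Ch rho) x.
Proof.
rewrite /Ch /= mxtrace_mxblock /induced_function [RHS]big_tnth.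
by apply: eq_bigr => i _; case: ifP => // _; rewrite linear0.
Qed.

Definition ind_block rho (x : G) (i j : 'I_(size (left_transversal H))) :
    'M[C]_(rdim rho) :=
  if ((t i)^-1 * x * t j)%g \in H then rho ((t i)^-1 * x * t j)%g else 0.

Lemma ind_repE rho x : ind_rep H rho x = \mxblock_(i, j) ind_block rho x i j.
Proof. by []. Qed.

(** In each row of blocks of an induced representation, exactly one block is
    nonzero. *)
Lemma ind_block_row rho x i : exists k,
  H ((t i)^-1 * x * t k)%g /\
  forall n (F : _ -> 'M[C]_(rdim rho, n)),
    \sum_j ind_block rho x i j *m F j = rho ((t i)^-1 * x * t k)%g *m F k.
Proof.
have [k kP] := transversal_row subgroupH finite_indexH x i; exists k; split.
  by apply/mem_iff; rewrite kP.
move=> n F; rewrite (bigD1 k) //= big1 ?addr0 => [|j /negPf jk].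
  by rewrite /ind_block kP eqxx.
by rewrite /ind_block kP jk mul0mx.
Qed.

Lemma ind_rep1 rho : unitary_rep H rho -> ind_rep H rho 1%g = 1%:M.
Proof.
move=> rU; rewrite -mxdiagZ ind_repE; apply: eq_mxblock => i j.
rewrite /ind_block mulg1 (transversal_diag subgroupH finite_indexH).
case: eqVneq => [->|//]; rewrite mulVg (rep1 rU).
by rewrite conform_mx_id.
Qed.

Lemma ind_repM rho x y : unitary_rep H rho ->
  ind_rep H rho (x * y)%g = ind_rep H rho x *m ind_rep H rho y.
Proof.
move=> rU; rewrite !ind_repE mul_mxblock; apply: eq_mxblock => i l.
have [k [Hk ->]] := ind_block_row rho x i.
have xyE : ((t i)^-1 * (x * y) * t l =
    ((t i)^-1 * x * t k) * ((t k)^-1 * y * t l))%g.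
  by rewrite !mulgA mulgK.
rewrite /ind_block xyE.
have [Hl|nHl] := boolP ((t k)^-1 * y * t l \in H)%g.
  have Hl' := iffLR (mem_iff _ _) Hl.
  rewrite ifT; last by apply/mem_iff; exact: (subgroupM subgroupH).
  by rewrite (repM rU).
rewrite mulmx0 ifF //; apply/negP => /mem_iff Hkl; move/negP: nHl; apply.
apply/mem_iff; rewrite -[X in H X](mulKg ((t i)^-1 * x * t k)%g).
exact: (subgroupM subgroupH (subgroupV subgroupH Hk) Hkl).
Qed.

Lemma ind_rep_conj_transpose rho x : unitary_rep H rho ->
  (ind_rep H rho x)^*t = ind_rep H rho x^-1%g.
Proof.
move=> rU; rewrite !ind_repE tr_mxblock.
have -> (B : forall i j, 'M[C]_(rdim rho)) :
    map_mx Num.conj (\mxblock_(i < size (left_transversal H),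
                               j < size (left_transversal H)) B i j)
    = \mxblock_(i, j) map_mx Num.conj (B i j).
  by apply/matrixP => a b; rewrite !mxE.
apply: eq_mxblock => i j; rewrite /ind_block.
have invE : ((t i)^-1 * x^-1 * t j = ((t j)^-1 * x * t i)^-1)%g.
  by rewrite !invgM !invgK !mulgA.
rewrite invE; have [Hm|nHm] := boolP (((t j)^-1 * x * t i)%g \in H).
  have Hm' := iffLR (mem_iff _ _) Hm.
  rewrite ifT; last by apply/mem_iff; exact: (subgroupV subgroupH).
  by rewrite (repV subgroupH rU).
rewrite ifF ?trmx0 ?map_mx0 //; apply/negP => /mem_iff/(subgroupV subgroupH).
by rewrite invgK => /mem_iff; apply/negP.
Qed.

(** H is both open and closed. *)
Lemma extension_by_zero_continuous (f : G -> C) : closed H ->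
  {within H, continuous f} -> continuous (fun x => if x \in H then f x else 0).
Proof.
move=> closedH fc x.
have openH := subgroup_open subgroupH finite_indexH closedH.
have [Hx|nHx] := pselect (H x).
  have cx : {for x, continuous f}.
    move: fc; rewrite continuous_open_subspace // => /(_ x); apply.
    exact/mem_iff.
  apply: cvg_trans; last by rewrite /= ifT; [exact: cx|exact/mem_iff].
  apply: near_eq_cvg; near=> y.
  by rewrite ifT //; apply/mem_iff; near: y; exact: open_nbhs_nbhs.
rewrite /continuous_at [X in _ --> X]ifF; last by apply/negP => /mem_iff.
apply: cvg_near_cst; near=> y.
rewrite ifF //; apply/negP => /mem_iff; near: y.
by apply: open_nbhs_nbhs; split=> //; exact: closed_openC.
Unshelve. all: by end_near. Qed.

Lemma unitary_ind rho : closed H -> unitary_rep H rho ->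
  unitary_rep [set: G] (ind_rep H rho).
Proof.
move=> closedH rU; split=> [|x y _ _|x _|].
- exact: ind_rep1.
- exact: ind_repM.
- apply/unitarymxP; rewrite ind_rep_conj_transpose // -ind_repM // mulgV.
  exact: ind_rep1.
- apply/within_mxP => a b.
  have entry x : ind_rep H rho x a b =
    ind_block rho x (tagnat.sig1 a) (tagnat.sig1 b) (tagnat.sig2 a) (tagnat.sig2 b).
    by rewrite ind_repE mxE.
  set i := tagnat.sig1 a in entry; set j := tagnat.sig1 b in entry.
  pose f (y : G) := rho y (tagnat.sig2 a) (tagnat.sig2 b).
  suff ec : continuous (fun x : G => ind_rep H rho x a b).
    by apply: (continuous_subspaceT ec).
  have -> : (fun x => ind_rep H rho x a b) =
     (fun y => if y \in H then f y else 0) \o (fun x => (t i)^-1 * x * t j)%g.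
    apply/funext => x; rewrite entry /ind_block /=; case: ifP => // _.
    by rewrite mxE.
  move=> x; apply: continuous_comp; first exact: conj_transl_continuous.
  apply: extension_by_zero_continuous => //.
  by case: rU => _ _ _ /within_mxP; apply.
Qed.

(** The invariant vectors of the induced representation are the (v, ..., v)
    with v invariant under H. Accordingly all the rows of blocks of the
    average S over G are equal, and the sum S' of the blocks in one row is a
    projection onto the invariant vectors of rho. It has the same trace as S,
    and the same trace as the average E0 over H since S' and E0 have the same
    image. *)
Lemma Frobenius_average rho m m0 : unitary_rep H rho ->
  invariant_average [set: G] m (ind_rep H rho) -> invariant_average H m0 rho ->
  average m (Ch (ind_rep H rho)) = average m0 (Ch rho).
Proof.
move=> rU [mw inv] [m0w inv0].
rewrite -!mxtrace_average.
set E0 := average_mx m0 rho in inv0 *.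
set S := average_mx m (ind_rep H rho) in inv *.
pose S_ i j : 'M[C]_(rdim rho) := submxblock S i j.
have SE : S = \mxblock_(i, j) S_ i j by rewrite submxblockK.
have S_inv x i k : \sum_j ind_block rho x i j *m S_ j k = S_ i k.
  have := inv x I; rewrite {1}SE ind_repE mul_mxblock SE.
  by move=> /eq_mxblockP/(_ i k).
have S_row i j k : S_ i k = S_ j k.
  (* this element carries the coset of t_j to that of t_i *)
  rewrite -(S_inv (t i * (t j)^-1)%g i k).
  have [l [Hl ->]] := ind_block_row rho (t i * (t j)^-1)%g i.
  move: Hl; rewrite mulgA mulVg mul1g => /mem_iff.
  rewrite (transversal_diag subgroupH finite_indexH) => /eqP->.
  by rewrite mulVg (rep1 rU) mul1mx.
have S_fix h i k : H h -> rho h *m S_ i k = S_ i k.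
  move=> Hh; rewrite -[in RHS](S_inv (t i * h * (t i)^-1)%g i k).
  (* this element stabilises the coset of t_i and acts on it as h *)
  have [l [Hl ->]] := ind_block_row rho (t i * h * (t i)^-1)%g i.
  have hE : ((t i)^-1 * (t i * h * (t i)^-1) * t l = h * ((t i)^-1 * t l))%g.
    by rewrite !mulgA mulVg mul1g.
  move: Hl; rewrite hE => Hl.
  have : H ((t i)^-1 * t l)%g.
    rewrite -[X in H X](mulKg h).
    exact: (subgroupM subgroupH (subgroupV subgroupH Hh)).
  move=> /mem_iff; rewrite (transversal_diag subgroupH finite_indexH) => /eqP <-.
  by rewrite mulVg mulg1.
have [i0 _] := transversal_index subgroupH finite_indexH 1%g.
pose S' := \sum_k S_ i0 k.
have -> : \tr S = \tr S'.
  rewrite SE mxtrace_mxblock /S' linear_sum; apply: eq_bigr => k _.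
  by rewrite (S_row k i0).
have E0S' : E0 *m S' = S'.
  apply: (average_fix m0w) => h Hh; rewrite /S' mulmx_sumr.
  by apply: eq_bigr => k _; exact: S_fix.
have S'E0 : S' *m E0 = E0.
  pose v := \mxcol_(i < size (left_transversal H)) E0.
  have Sv : S *m v = v.
    apply: (average_fix mw) => x _; rewrite ind_repE mul_mxblock_mxrow.
    apply/eq_mxcolP => i.
    by have [k [Hk ->]] := ind_block_row rho x i; rewrite inv0.
  move: Sv; rewrite SE /v mul_mxblock_mxrow => /eq_mxcolP/(_ i0).
  by rewrite -mulmx_suml.
by rewrite -E0S' mxtrace_mulC S'E0.
Qed.

End InducedRep.

(** * Convex combinations close to the invariant average *)

Section ConvexApproximation.
Variables (C : numClosedFieldType) (G : topologicalGroupType) (H : set G).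
Hypothesis subgroupH : is_subgroup H.
Hypothesis archiC : forall x : C, exists n : nat, `|x| < n%:R.
Implicit Types rho sigma : rep C G.

Definition convex_weights (m : seq (C * G)) : Prop :=
  affine_weights H m /\ {in m, forall p, 0 <= p.1}.

(** A crude bound whose constant depends on m only. *)
Lemma hsdot_combination (m : seq (C * G)) k n :
  exists2 K : C, 0 < K & forall Y : G -> 'M[C]_(k, n),
    hsdot (\sum_(p <- m) p.1 *: Y p.2) (\sum_(p <- m) p.1 *: Y p.2)
    <= K * \sum_(p <- m) hsdot (Y p.2) (Y p.2).
Proof.
elim: m => [|[c h] m [K K_gt0 IH]].
  by exists 1 => // Y; rewrite !big_nil /hsdot mul0mx linear0 mulr0.
exists (2%:R * `|c| ^+ 2 + 2%:R * K) => [|Y].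
  by rewrite ltr_wpDl ?mulr_gt0 // mulr_ge0 // exprn_ge0.
rewrite !big_cons /=; set Z := \sum_(p <- m) _; set S := \sum_(p <- m) _.
have S_ge0 : 0 <= S by apply: sumr_ge0 => p _; exact: hsdot_ge0.
have par : hsdot (c *: Y h + Z) (c *: Y h + Z) <=
    2%:R * (hsdot (c *: Y h) (c *: Y h) + hsdot Z Z).
  by rewrite -hsdot_parallelogram lerDl hsdot_ge0.
apply: (le_trans par); rewrite hsdotZl hsdotZr mulrA -normCK.
have Yh := hsdot_ge0 (Y h).
have {}IH : hsdot Z Z <= K * S by exact: IH.
set a := hsdot (Y h) (Y h) in Yh *; set z := hsdot Z Z in IH *.
set c2 := `|c| ^+ 2; have c2_ge0 : 0 <= c2 by exact: exprn_ge0.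
rewrite -subr_ge0 (_ : _ - _ =
  2%:R * K * a + 2%:R * c2 * S + 2%:R * (K * S - z)); last by ring.
have K_ge0 := ltW K_gt0.
by rewrite !addr_ge0 // ?mulr_ge0 ?subr_ge0 // ?mulr_ge0 ?ler0n.
Qed.

Section Contraction.
Variables (m : seq (C * G)) (sigma : rep C G).
Hypotheses (sU : unitary_rep H sigma) (mP : invariant_average H m sigma).
Let E := average_mx m sigma.

(** Since X E = 0, the matrix X = X (1 - E) is a combination of the X - X
    sigma h, for h in m; hence one of these is not much smaller than X. *)
Lemma some_displacement : exists2 L : C, 0 < L &
  forall X : 'M[C]_(rdim sigma), X *m E = 0 ->
  exists2 h, H h & hsdot X X <= L * hsdot (X - X *m sigma h) (X - X *m sigma h).
Proof.
have [[mH m1] _] := mP.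
have [K K_gt0 KP] := hsdot_combination m (rdim sigma) (rdim sigma).
have m_gt0 : (0 < size m)%N.
  by case: (m) m1 => //; rewrite big_nil => /esym/eqP; rewrite oner_eq0.
have L_gt0 : 0 < K * (size m)%:R by rewrite mulr_gt0 // ltr0n.
exists (K * (size m)%:R) => // X XE.
apply: contrapT => no.
pose Y h := X - X *m sigma h.
have lt_p p : p \in m -> K * (size m)%:R * hsdot (Y p.2) (Y p.2) < hsdot X X.
  move=> pm; rewrite real_ltNge ?ger0_real ?hsdot_ge0 //; last first.
    by rewrite mulr_ge0 ?hsdot_ge0 // ltW.
  by apply/negP => le_p; apply: no; exists p.2 => //; exact: mH.
have XY : X = \sum_(p <- m) p.1 *: Y p.2.
  have X1 : X = \sum_(p <- m) p.1 *: X by rewrite -scaler_suml m1 scale1r.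
  rewrite -[LHS]subr0 -[X in _ - X]XE /E /average_mx mulmx_sumr [X in X - _]X1.
  rewrite -sumrB; apply: eq_bigr => p _.
  by rewrite scalerBr scalemxAr.
have := KP Y; rewrite -XY => le_sum.
have : (size m)%:R * hsdot X X < (size m)%:R * hsdot X X.
  apply: (@le_lt_trans _ _ (\sum_(p <- m) K * (size m)%:R * hsdot (Y p.2) (Y p.2))).
    by rewrite -mulr_sumr mulrAC mulrC ler_pM2r // ltr0n.
  rewrite [X in _ < X](_ : _ = \sum_(p <- m) hsdot X X); last first.
    by rewrite big_const_seq count_predT iter_addr_0 mulr_natl.
  rewrite big_seq [X in _ < X]big_seq; apply: ltr_sum => //.
  by apply/hasP; exists (nth (0, 1%g) m 0); rewrite mem_nth.
by rewrite ltxx.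
Qed.

(** Replacing a convex combination by its midpoint with a suitable right
    translate shrinks the distance to E by a fixed factor: this is the
    parallelogram identity together with some_displacement. The geometric
    decay is stated in the weaker form of Bernoulli's inequality, to which the
    archimedean property applies directly. *)
Lemma convex_contraction : exists2 d : C, 0 < d & forall n : nat,
  exists m', convex_weights m' /\
  hsdot (average_mx m' sigma - E) (average_mx m' sigma - E) * (1 + n%:R * d)
    <= hsdot (1%:M - E) (1%:M - E).
Proof.
have [[mH m1] inv] := mP.
have [L L_gt0 LP] := some_displacement.
have d_gt0 : 0 < (4%:R * L)^-1 by rewrite invr_gt0 mulr_gt0 // ltr0n.
exists (4%:R * L)^-1 => //; elim=> [|n [m' [[[m'H m'1] m'0] IH]]].
  exists [:: (1, 1%g)]; split.
    split; last by move=> p; rewrite inE => /eqP->.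
    split; last by rewrite big_seq1.
    by move=> p; rewrite inE => /eqP->; exact: (subgroup1 subgroupH).
  by rewrite /average_mx big_seq1 scale1r (rep1 sU) mul0r addr0 mulr1.
set X := average_mx m' sigma - E in IH.
have XE : X *m E = 0.
  rewrite mulmxBl (average_idem mP) (average_fix (H := H)) ?subrr //.
have [h Hh hP] := LP X XE.
(* the midpoint of the combination and of its right translate by h *)
pose m2 := [seq (2%:R^-1 * p.1, p.2) | p <- m'] ++
  [seq (2%:R^-1 * p.1, (p.2 * h)%g) | p <- m'].
have half : 2%:R^-1 + 2%:R^-1 = 1 :> C.
  by rewrite -mulr2n -[_ *+ 2]mulr_natr mulVf // pnatr_eq0.
exists m2; split.
  split; last first.
    move=> p; rewrite mem_cat => /orP[] /mapP[q qm ->] /=;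
    by rewrite mulr_ge0 ?invr_ge0 ?ler0n ?m'0.
  split.
    move=> p; rewrite mem_cat => /orP[] /mapP[q /m'H Hq ->] //=.
    exact: (subgroupM subgroupH).
  by rewrite big_cat !big_map /= -!mulr_sumr m'1 !mulr1.
have X2 : average_mx m2 sigma - E = 2%:R^-1 *: (X + X *m sigma h).
  rewrite mulmxBl (average_invr subgroupH sU mP) //.
  rewrite scalerDr !scalerBr addrACA -opprD -scalerDl half scale1r.
  congr (_ - _); rewrite {1}/average_mx big_cat !big_map /=; congr (_ + _).
    by rewrite scaler_sumr; apply: eq_bigr => p _; rewrite scalerA.
  rewrite mulmx_suml scaler_sumr; apply: eq_big_seq => p /m'H Hp.
  by rewrite (repM sU) // -scalemxAl scalerA.
have f2 : hsdot (average_mx m2 sigma - E) (average_mx m2 sigma - E) =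
    hsdot X X - 4%:R^-1 * hsdot (X - X *m sigma h) (X - X *m sigma h).
  have := hsdot_parallelogram X (X *m sigma h).
  rewrite (hsdot_unitaryr _ (rep_unitary sU Hh)) X2 hsdotZl hsdotZr.
  move=> par; rewrite -(addrK (hsdot (X - X *m sigma h) (X - X *m sigma h))
    (hsdot (X + _) _)) par.
  by rewrite fmorphV rmorph_nat; field.
rewrite f2; apply: le_trans _ IH.
have X_ge0 := hsdot_ge0 X.
have Y_ge := hP.
set y := hsdot (X - _) _ in Y_ge *; set x := hsdot X X in Y_ge X_ge0 *.
set d := (4%:R * L)^-1 in d_gt0 *.
have dx : d * x <= 4%:R^-1 * y.
  rewrite /d invfM -mulrA ler_pM2l ?invr_gt0 ?ltr0n //.
  by rewrite mulrC ler_pdivrMr // mulrC.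
have step : x - 4%:R^-1 * y <= x - d * x by rewrite lerD2l lerN2.
have nd : 0 <= n%:R * d by rewrite mulr_ge0 ?ler0n // ltW.
have nd1 : 0 <= 1 + n.+1%:R * d by rewrite addr_ge0 // mulr_ge0 ?ler0n // ltW.
apply: (@le_trans _ _ ((x - d * x) * (1 + n.+1%:R * d))).
  exact: ler_wpM2r.
rewrite -subr_ge0 (_ : _ - _ = d ^+ 2 * n.+1%:R * x); last first.
  by rewrite -natr1; ring.
by rewrite !mulr_ge0 ?ler0n ?exprn_ge0 // ltW.
Qed.

Lemma convex_approximation e : 0 < e -> exists m', convex_weights m' /\
  hsdot (average_mx m' sigma - E) (average_mx m' sigma - E) <= e.
Proof.
move=> e0; have [d d0 dP] := convex_contraction.
set f0 := hsdot (1%:M - E) _ in dP.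
have f0_ge0 : 0 <= f0 by exact: hsdot_ge0.
have [n nP] := archiC (f0 / (d * e)).
have de0 : 0 < d * e by rewrite mulr_gt0.
have [m' [m'P le_f]] := dP n; exists m'; split=> //.
set f := hsdot _ _ in le_f *.
have nd : 0 < 1 + n%:R * d by rewrite ltr_wpDr // mulr_ge0 ?ler0n // ltW.
rewrite -(ler_pM2r nd); apply: (le_trans le_f).
move: nP; rewrite ger0_norm; last by rewrite divr_ge0 // ltW.
rewrite ltr_pdivrMr // => /ltW/le_trans; apply.
by rewrite -subr_ge0 (_ : _ - _ = e) ?ltW //; ring.
Qed.

End Contraction.

Lemma hsdot_sum_rep (s : seq (rep C G)) m m' : {in s, forall r,
  hsdot (average_mx m' r - average_mx m r) (average_mx m' r - average_mx m r)
  <= hsdot (average_mx m' (sum_rep s) - average_mx m (sum_rep s))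
       (average_mx m' (sum_rep s) - average_mx m (sum_rep s))}.
Proof.
elim: s => // r s IH r'.
have -> : hsdot (average_mx m' (sum_rep (r :: s)) - average_mx m (sum_rep (r :: s)))
       (average_mx m' (sum_rep (r :: s)) - average_mx m (sum_rep (r :: s))) =
  hsdot (average_mx m' r - average_mx m r) (average_mx m' r - average_mx m r)
  + hsdot (average_mx m' (sum_rep s) - average_mx m (sum_rep s))
       (average_mx m' (sum_rep s) - average_mx m (sum_rep s)).
  rewrite /= !average_add opp_block_mx add_block_mx !subr0.
  rewrite /hsdot tr_block_mx map_block_mx !trmx0 !map_mx0 mulmx_block.
  by rewrite !(mulmx0, mul0mx, addr0, add0r) mxtrace_block.
rewrite inE => /predU1P[->|/IH le_s]; first by rewrite lerDl hsdot_ge0.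
by apply: (le_trans le_s); rewrite lerDr hsdot_ge0.
Qed.

(** Convex combinations close to the average for the direct sum are close to
    it for each summand. *)
Lemma convex_average (s : seq (rep C G)) m e :
  {in s, forall r, unitary_rep H r} -> invariant_average H m (sum_rep s) ->
  0 < e -> exists m', convex_weights m' /\
  {in s, forall r, `|average m' (Ch r) - average m (Ch r)| ^+ 2 <= e}.
Proof.
move=> sU mP e0; set N := (rdim (sum_rep s)).
have N0 : 0 < (N.+1)%:R :> C by rewrite ltr0n.
have [|m' [m'P le_f]] :=
  @convex_approximation m (sum_rep s) (unitary_sum sU) mP (e / N.+1%:R).
  by rewrite divr_gt0.
exists m'; split=> // r rs; rewrite -!mxtrace_average -linearB /=.
apply: (le_trans (mxtrace_hsdot _)).
have le_r := le_trans (hsdot_sum_rep m m' rs) le_f.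
have dim_le : (rdim r <= N)%N.
  rewrite /N; elim: (s) rs => // r' s' IH; rewrite inE => /predU1P[->|/IH le_s].
    exact: leq_addr.
  exact: leq_trans le_s (leq_addl _ _).
apply: (@le_trans _ _ (N.+1%:R * (e / N.+1%:R))).
  by apply: ler_pM => //; rewrite ?ler0n ?hsdot_ge0 // ler_nat ltnW.
by rewrite mulrC divfK // gt_eqF.
Qed.

End ConvexApproximation.

(** * Countability of the dual *)

Section Countability.
Variables (C : numClosedFieldType) (G : topologicalGroupType) (H : set G).
Hypothesis subgroupH : is_subgroup H.
Hypothesis archiC : forall x : C, exists n : nat, `|x| < n%:R.
Variable dense : nat -> C.
Hypothesis denseP : forall x e : C, 0 < e -> exists n, `|x - dense n| < e.

Lemma convex_average_norm m (f : G -> C) e : convex_weights H m ->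
  (forall x, H x -> `|f x| <= e) -> `|average m f| <= e.
Proof.
move=> [[mH m1] m0] fe; apply: (le_trans (ler_norm_sum _ _ _)).
rewrite -[X in _ <= X]mul1r -m1 mulr_suml.
rewrite big_seq [X in _ <= X]big_seq; apply: ler_sum => p pm.
by rewrite normrM ger0_norm ?m0 // ler_wpM2l ?m0 //; apply: fe; exact: mH.
Qed.

(** If p and q differ, the square of the modulus of the difference of their
    characters has mean value 1 + 1 = 2; a convex combination of values at
    most 1/4 cannot come close to it. *)
Lemma dual_separated (p q : dual C H) :
  (forall x, H x -> `|Ch (dual_rep p) x - Ch (dual_rep q) x| <= 2%:R^-1) -> p = q.
Proof.
move=> pq_close; apply: contrapT => /eqP npq.
pose r (a b : dual C H) := tens_rep (conj_rep (dual_rep a)) (dual_rep b).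
pose s := [:: r p p; r p q; r q p; r q q].
have sU : {in s, forall t, unitary_rep H t}.
  have rU a b : unitary_rep H (r a b).
    exact: unitary_tens (unitary_conj (dual_unitary a)) (dual_unitary b).
  by move=> t; rewrite !inE => /or4P[] /eqP->.
have [m mP] := exists_invariant_average1 subgroupH (unitary_sum sU).
(* the four mean values are approximated up to 1/4, for a total error of 1 *)
have e0 : 0 < 4%:R^-1 ^+ 2 :> C by rewrite exprn_gt0 // invr_gt0 ltr0n.
have [m' [m'P close]] := convex_average subgroupH archiC sU mP e0.
have rP := invariant_average_sum mP.
have le4 a b : r a b \in s -> `|average m' (Ch (r a b)) - (a == b)%:R| <= 4%:R^-1.
  move=> rs; rewrite -(character_orthogonality (rP _ rs)).
  have := close _ rs; rewrite ler_pXn2r // ?nnegrE ?normr_ge0 //.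
  by rewrite invr_ge0 ler0n.
pose f x := `|Ch (dual_rep p) x - Ch (dual_rep q) x| ^+ 2.
have f_le : `|average m' f| <= 4%:R^-1.
  apply: convex_average_norm => // x Hx.
  rewrite /f ger0_norm ?exprn_ge0 //.
  apply: (@le_trans _ _ (2%:R^-1 ^+ 2)); last by rewrite exprVn -natrX.
  by rewrite ler_pXn2r ?nnegrE ?invr_ge0 ?ler0n //; exact: pq_close.
have fE : average m' f = average m' (Ch (r p p)) - average m' (Ch (r p q))
    - average m' (Ch (r q p)) + average m' (Ch (r q q)).
  rewrite -!sumrB -big_split; apply: eq_bigr => -[c h] _ /=.
  by rewrite /f normCK rmorphB !Ch_tens !Ch_conj; ring.
have := le4 p p; have := le4 p q; have := le4 q p; have := le4 q q.
rewrite !inE !eqxx !orbT /= [q == p]eq_sym (negPf npq) /= !subr0.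
move=> /(_ isT) qq /(_ isT) qp /(_ isT) pq /(_ isT) pp.
pose e4 : C := 4%:R^-1.
have : `|2%:R : C| <= e4 + e4 + e4 + e4 + e4.
  have -> : 2%:R = average m' f - (average m' (Ch (r p p)) - 1) +
      average m' (Ch (r p q)) + average m' (Ch (r q p))
      - (average m' (Ch (r q q)) - 1) by rewrite fE; ring.
  apply: (le_trans (ler_normB _ _)); apply: lerD => //.
  apply: (le_trans (ler_normD _ _)); apply: lerD => //.
  apply: (le_trans (ler_normD _ _)); apply: lerD => //.
  by apply: (le_trans (ler_normB _ _)); apply: lerD.
have -> : e4 + e4 + e4 + e4 + e4 = 5%:R / 4%:R by rewrite /e4; field.
by rewrite normr_nat ler_pdivlMr ?ltr0n // -natrM ler_nat.
Qed.

(** By continuity the character is nearly constant on a basic open set around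
    each point, and finitely many of these sets cover H. *)
Lemma character_code (p : dual C H) (B : set (set G)) : compact H -> basis B ->
  exists s : seq (set G * nat),
  [/\ {in s, forall c, B c.1},
      forall x, H x -> exists2 c, c \in s & c.1 x
    & {in s, forall c y, H y -> c.1 y ->
        `|Ch (dual_rep p) y - dense c.2| < 4%:R^-1}].
Proof.
move=> compactH [Bopen Bbasis].
have local x : exists c : set G * nat, H x -> [/\ B c.1, c.1 x &
    forall y, H y -> c.1 y -> `|Ch (dual_rep p) y - dense c.2| < 4%:R^-1].
  have [Hx|nHx] := pselect (H x); last by exists (set0, 0%N).
  have e0 : 0 < 8%:R^-1 :> C by rewrite invr_gt0 ltr0n.
  have [n xn] := denseP (Ch (dual_rep p) x) e0.
  have cont : {within H, continuous (Ch (dual_rep p))}.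
    by apply: within_mxtrace; case: (dual_unitary p).
  have /subspace_continuousP/(_ x Hx)/cvgrPdist_lt/(_ _ e0) := cont.
  rewrite near_withinE => /Bbasis[U [BU Ux] sU].
  exists (U, n) => _; split=> // y Hy Uy /=.
  have := sU y Uy Hy; rewrite distrC => yx.
  rewrite -(subrK (Ch (dual_rep p) x) (Ch _ y)) -addrA.
  apply: (le_lt_trans (ler_normD _ _)).
  have -> : 4%:R^-1 = 8%:R^-1 + 8%:R^-1 :> C by field.
  exact: ltrD.
have [code codeP] := choice local.
have coverH : cover_compact H.
  (* the unit is the base point of G for the covering form of compactness *)
  pose pG := isPointed.Build G (1%g : G).
  pose G' : ptopologicalType := HB.pack G pG.
  by have := compactH : @compact G' H; rewrite compact_cover.
have := coverH G H (fun x => (code x).1).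
case=> [x Hx|x Hx|D DH Dcover].
- by have [/Bopen] := codeP x Hx.
- by exists x => //; have [] := codeP x Hx.
exists [seq code x | x <- D]; split.
- by move=> c /mapP[x /DH/set_mem Hx ->]; have [] := codeP x Hx.
- move=> x /Dcover[y /= yD cy]; exists (code y) => //; exact: map_f.
- by move=> c /mapP[x /DH/set_mem Hx ->]; have [] := codeP x Hx.
Qed.

(** A list as in character_code determines the character up to 1/2, hence the
    class. *)
Lemma countable_dual : compact H -> @second_countable G ->
  countable [set: dual C H].
Proof.
move=> compactH [B /countable_injP[f f_inj] basisB].
have [code codeP] := choice (fun p => character_code p compactH basisB).
apply/countable_injP.
exists (fun p => choice.pickle [seq (f c.1, c.2) | c <- code p]).
move=> p q _ _ /(pcan_inj (@choice.pickleK _)) pq.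
have {pq} codeE : code p = code q.
  have [Bp _ _] := codeP p; have [Bq _ _] := codeP q.
  elim: (code p) (code q) Bp Bq pq => [|c s IH] [|c' s'] //= Bp Bq [fE nE sE].
  congr cons.
    have /f_inj := fE => /(_ _ _) E.
    rewrite (surjective_pairing c) (surjective_pairing c') nE E //; apply: mem_set.
      by apply: Bp; rewrite mem_head.
    by apply: Bq; rewrite mem_head.
  by apply: IH sE => d ds; [apply: Bp|apply: Bq]; rewrite inE ds orbT.
apply: dual_separated => x Hx.
have [_ cover_p close_p] := codeP p; have [_ _ close_q] := codeP q.
have [c cp cx] := cover_p x Hx.
have px := close_p c cp x Hx cx.
have qx : `|Ch (dual_rep q) x - dense c.2| < 4%:R^-1.
  by apply: close_q => //; rewrite -codeE.
have -> : Ch (dual_rep p) x - Ch (dual_rep q) x =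
  (Ch (dual_rep p) x - dense c.2) - (Ch (dual_rep q) x - dense c.2) by ring.
apply: (le_trans (ler_normB _ _)).
have -> : 2%:R^-1 = 4%:R^-1 + 4%:R^-1 :> C by field.
by apply: lerD; exact: ltW.
Qed.

End Countability.

(** * The convolution in terms of characters *)

Section SymbolAlgebra.
Variables (C : numClosedFieldType) (G : topologicalGroupType) (H : set G).
Hypotheses (subgroupH : is_subgroup H) (closedH : closed H).
Hypothesis finite_indexH : finite_set (left_cosets H).

Local Notation symb := (symbols C H).
Local Notation CF := {formal C[symb]}.
Local Notation conv := (symbols_conv C H).
Local Notation star := (symbols_star C H).
Implicit Types (a b c : CF) (sigma : rep C G).

Lemma subgroupT : is_subgroup [set: G]. Proof. by []. Qed.

Lemma unitary_restrict sigma : unitary_rep [set: G] sigma -> unitary_rep H sigma.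
Proof.
move=> sU; split=> [|x y _ _|x _|].
- exact: rep1 sU.
- by apply: (repM sU).
- by apply: (rep_unitary sU).
- by apply: (continuous_subspaceW (B := [set: G])); case: sU.
Qed.

Definition white_class (s : symb) : option (dual C [set: G]) :=
  if s is inl p then Some p else None.

Definition black_class (s : symb) : option (dual C H) :=
  if s is inr p then Some p else None.

Lemma white_classE s p : white_class s = Some p <-> s = inl p.
Proof. by case: s => q /=; split => // -[->]. Qed.

Lemma black_classE s p : black_class s = Some p <-> s = inr p.
Proof. by case: s => q /=; split => // -[->]. Qed.

(* the functions f and k attached to a formal sum *)
Local Notation wchar := (char_sum white_class).
Local Notation bchar := (char_sum black_class).

(** Linear independence of the irreducible characters of G and of those of H.
    *)
Lemma symbols_eq a b :
  (forall x, wchar a x = wchar b x) -> (forall x, H x -> bchar a x = bchar b x) -> a = b.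
Proof.
move=> Wab Kab; apply/malgP => -[] p.
  exact: (char_sum_inj subgroupT white_classE (fun x _ => Wab x)).
exact: (char_sum_inj subgroupH black_classE Kab).
Qed.

Lemma formal_ind (P : CF -> Prop) : P 0 ->
  (forall k s a, P a -> P (k *: fbasis s + a)) -> forall a, P a.
Proof.
move=> P0 PD a; rewrite (monalgE a); elim: (enum_fset _) => [|s l IH].
  by rewrite big_nil.
rewrite big_cons.
rewrite (_ : mkmalgU s (fcoef s a) = fcoef s a *: fbasis s); first exact: PD.
by apply/malgP => t; rewrite mcoeffZ !mcoeffU mulr_natr.
Qed.

Lemma wchar_white sigma x : unitary_rep [set: G] sigma ->
  wchar (white H sigma) x = Ch sigma x.
Proof.
move=> sU; rewrite char_sum_sum (Ch_constituents subgroupT sU) //.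
by apply: eq_bigr => p _; rewrite char_sum_basis.
Qed.

Lemma bchar_white sigma x : bchar (white H sigma) x = 0.
Proof. by rewrite char_sum_sum big1 // => p _; rewrite char_sum_basis. Qed.

Lemma bchar_black sigma x : unitary_rep H sigma -> H x ->
  bchar (black H sigma) x = Ch sigma x.
Proof.
move=> sU Hx; rewrite char_sum_sum (Ch_constituents subgroupH sU) //.
by apply: eq_bigr => p _; rewrite char_sum_basis.
Qed.

Lemma wchar_black sigma x : wchar (black H sigma) x = 0.
Proof. by rewrite char_sum_sum big1 // => p _; rewrite char_sum_basis. Qed.

Lemma induced_ext (f g : G -> C) x : (forall y, H y -> f y = g y) ->
  induced_function H f x = induced_function H g x.
Proof.
move=> fg; apply: eq_bigr => t _; case: ifP => // /mem_iff Ht; exact: fg.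
Qed.

Lemma induced_linear k (f g : G -> C) x :
  induced_function H (fun y => k * f y + g y) x =
  k * induced_function H f x + induced_function H g x.
Proof.
rewrite /induced_function mulr_sumr -big_split; apply: eq_bigr => t _ /=.
by case: ifP => _; rewrite ?mulr0 ?addr0.
Qed.

Lemma induced0 x : induced_function H (fun=> 0 : C) x = 0.
Proof. by rewrite /induced_function big1 // => t _; case: ifP. Qed.

Lemma inducedD (f g : G -> C) x :
  induced_function H (fun y => f y + g y) x =
  induced_function H f x + induced_function H g x.
Proof.
rewrite -[X in X + _]mul1r -induced_linear.
by apply: induced_ext => y _; rewrite mul1r.
Qed.

(** Projection formula: inducing commutes with the multiplication by a
    function that is constant on the trace on H of the conjugacy class of x.
    *)
Lemma induced_projection (f g : G -> C) x :
  (forall t, H (t^-1 * x * t)%g -> g (t^-1 * x * t)%g = g x) ->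
  induced_function H (fun y => f y * g y) x = induced_function H f x * g x.
Proof.
move=> gx; rewrite mulr_suml; apply: eq_bigr => t _.
by case: ifP => [/mem_iff/gx->//|_]; rewrite mul0r.
Qed.

Lemma wchar_symbol_mul (s t : symb) x : wchar (symbol_mul s t) x =
  wchar (fbasis s) x * wchar (fbasis t) x +
  induced_function H (fun y => bchar (fbasis s) y * bchar (fbasis t) y) x.
Proof.
rewrite !char_sum_basis (induced_ext (g := fun y =>
   oapp (fun p => Ch (dual_rep p) y) 0 (black_class s) *
   oapp (fun p => Ch (dual_rep p) y) 0 (black_class t))); last first.
  by move=> y _; rewrite !char_sum_basis.
case: s t => p [] q /=.
- rewrite wchar_white; last exact: unitary_tens (dual_unitary p) (dual_unitary q).
  rewrite Ch_tens -[LHS]addr0; congr (_ + _).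
  by rewrite -[LHS](induced0 x); apply: induced_ext => y _; rewrite mul0r.
- rewrite wchar_black mulr0 add0r -[LHS](induced0 x).
  by apply: induced_ext => y _; rewrite mul0r.
- rewrite wchar_black mul0r add0r -[LHS](induced0 x).
  by apply: induced_ext => y _; rewrite mulr0.
- rewrite mul0r add0r wchar_white; last first.
    apply: unitary_ind => //; exact: unitary_tens (dual_unitary p) (dual_unitary q).
  rewrite Ch_ind; apply: induced_ext => y _; exact: Ch_tens.
Qed.

Lemma bchar_symbol_mul (s t : symb) x : H x -> bchar (symbol_mul s t) x =
  wchar (fbasis s) x * bchar (fbasis t) x + bchar (fbasis s) x * wchar (fbasis t) x.
Proof.
move=> Hx; rewrite !char_sum_basis.
have rU (p : dual C [set: G]) : unitary_rep H (dual_rep p).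
  exact: unitary_restrict (dual_unitary p).
case: s t => p [] q /=.
- by rewrite bchar_white mulr0 mul0r addr0.
- rewrite bchar_black // ?Ch_tens ?mul0r ?addr0 //.
  exact: unitary_tens (rU p) (dual_unitary q).
- rewrite bchar_black // ?Ch_tens ?mul0r ?add0r //.
  exact: unitary_tens (dual_unitary p) (rU q).
- by rewrite bchar_white mulr0 mul0r addr0.
Qed.

Lemma conv0l a : conv 0 a = 0.
Proof. by rewrite /symbols_conv /bilinear_ext msupp0 big_seq_fset0. Qed.

Lemma conv0r a : conv a 0 = 0.
Proof.
by rewrite /symbols_conv /bilinear_ext big1 // => s _; rewrite msupp0 big_seq_fset0.
Qed.

Lemma star0 : star 0 = 0.
Proof. by rewrite /symbols_star /conj_linear_ext msupp0 big_seq_fset0. Qed.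

Lemma wchar_conv a b x : wchar (conv a b) x =
  wchar a x * wchar b x + induced_function H (fun y => bchar a y * bchar b y) x.
Proof.
elim/formal_ind: a b => [b|k s a IH b].
  rewrite conv0l !char_sum0 mul0r add0r -[LHS](induced0 x).
  by apply: induced_ext => y _; rewrite char_sum0 mul0r.
rewrite [conv _ _]bilinear_ext_linearl !char_sum_linear.
rewrite [wchar (bilinear_ext _ a b) x]IH (induced_ext
  (f := fun y => bchar (_ + a) y * bchar b y) (g := fun y =>
   k * (bchar (fbasis s) y * bchar b y) + bchar a y * bchar b y)); last first.
  by move=> y _; rewrite char_sum_linear mulrDl mulrA.
rewrite induced_linear.
suff -> : wchar (bilinear_ext (@symbol_mul C G H) (fbasis s) b) x =
  wchar (fbasis s) x * wchar b x + induced_function H (fun y => bchar (fbasis s) y * bchar b y) x.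
  by ring.
elim/formal_ind: b {IH} => [|l t b IH].
  rewrite [bilinear_ext _ _ _]conv0r !char_sum0 mulr0 add0r -[LHS](induced0 x).
  by apply: induced_ext => y _; rewrite char_sum0 mulr0.
rewrite bilinear_ext_linearr !char_sum_linear bilinear_ext_basis IH wchar_symbol_mul.
rewrite (induced_ext (f := fun y => bchar (fbasis s) y * bchar (_ + b) y) (g := fun y =>
   l * (bchar (fbasis s) y * bchar (fbasis t) y) + bchar (fbasis s) y * bchar b y)); last first.
  by move=> y _; rewrite char_sum_linear mulrDr mulrCA.
rewrite induced_linear; ring.
Qed.

Lemma bchar_conv a b x : H x -> bchar (conv a b) x = wchar a x * bchar b x + bchar a x * wchar b x.
Proof.
move=> Hx; elim/formal_ind: a b => [b|k s a IH b].
  by rewrite conv0l !char_sum0 !mul0r add0r.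
rewrite [conv _ _]bilinear_ext_linearl !char_sum_linear.
rewrite [bchar (bilinear_ext _ a b) x]IH.
suff -> : bchar (bilinear_ext (@symbol_mul C G H) (fbasis s) b) x =
  wchar (fbasis s) x * bchar b x + bchar (fbasis s) x * wchar b x by ring.
elim/formal_ind: b {IH} => [|l t b IH].
  by rewrite [bilinear_ext _ _ _]conv0r !char_sum0 !mulr0 add0r.
rewrite bilinear_ext_linearr !char_sum_linear bilinear_ext_basis IH bchar_symbol_mul //.
ring.
Qed.

Lemma wchar_star a x : wchar (star a) x = (wchar a x)^*.
Proof.
elim/formal_ind: a => [|k s a IH].
  by rewrite star0 char_sum0 rmorph0.
rewrite [star _]conj_linear_ext_linear !char_sum_linear.
rewrite [wchar (conj_linear_ext _ a) x]IH.
rewrite rmorphD rmorphM conj_linear_ext_basis char_sum_basis; congr (_ * _ + _).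
case: s => p /=; last by rewrite wchar_black rmorph0.
rewrite wchar_white ?Ch_conj //; exact: unitary_conj (dual_unitary p).
Qed.

Lemma bchar_star a x : H x -> bchar (star a) x = (bchar a x)^*.
Proof.
move=> Hx; elim/formal_ind: a => [|k s a IH].
  by rewrite star0 char_sum0 rmorph0.
rewrite [star _]conj_linear_ext_linear !char_sum_linear.
rewrite [bchar (conj_linear_ext _ a) x]IH.
rewrite rmorphD rmorphM conj_linear_ext_basis char_sum_basis; congr (_ * _ + _).
case: s => p /=; first by rewrite bchar_white rmorph0.
rewrite bchar_black ?Ch_conj //; exact: unitary_conj (dual_unitary p).
Qed.

Lemma Ch_conjg sigma x y : unitary_rep [set: G] sigma ->
  Ch sigma (y * x * y^-1)%g = Ch sigma x.
Proof.
move=> sU; rewrite /Ch !(repM sU) // mxtrace_mulC mulmxA -(repM sU) // mulVg.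
by rewrite (rep1 sU) mul1mx.
Qed.

Lemma wchar_conjg a x y : wchar a (y * x * y^-1)%g = wchar a x.
Proof.
apply: eq_bigr => s _; congr (_ * _); case: s => p //=.
exact: Ch_conjg (dual_unitary p).
Qed.

Lemma admissible_bchar a x t : admissible C H -> H x -> H (t^-1 * x * t)%g ->
  bchar a (t^-1 * x * t)%g = bchar a x.
Proof.
move=> adm Hx Hy; apply: eq_bigr => s _; congr (_ * _); case: s => p //=.
have [dim_gt0 _] := dual_irreducible p.
have := adm _ (dual_unitary p) (dual_irreducible p) x Hx (t^-1)%g.
rewrite /Xset /= invgK => /(_ Hy); apply: mulfI.
by rewrite invr_neq0 // pnatr_eq0 -lt0n.
Qed.

(** On G, projection formula for the characters of G. On H, admissibility
    makes the characters of H constant on the trace of a conjugacy class of G,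
    so the projection formula applies to them as well. *)
Lemma admissible_assoc : admissible C H -> associative conv.
Proof.
move=> adm a b c; apply: symbols_eq => x; last first.
  move=> Hx; rewrite !bchar_conv // !wchar_conv.
  rewrite (induced_projection (bchar b)); last by move=> t; exact: admissible_bchar.
  rewrite (induced_ext (f := fun y => bchar a y * bchar b y)
    (g := fun y => bchar b y * bchar a y)); last first.
    by move=> y _; rewrite mulrC.
  rewrite (induced_projection (bchar b)); last by move=> t; exact: admissible_bchar.
  by ring.
have wchar_class d t : wchar d (t^-1 * x * t)%g = wchar d x.
  by rewrite -[X in (_ * X)%g]invgK wchar_conjg.
rewrite !wchar_conv.
rewrite (induced_ext (f := fun y => bchar a y * bchar (conv b c) y)
  (g := fun y => bchar a y * bchar c y * wchar b y + bchar a y * bchar b y * wchar c y)); last first.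
  by move=> y Hy; rewrite bchar_conv //; ring.
rewrite (induced_ext (f := fun y => bchar (conv a b) y * bchar c y)
  (g := fun y => bchar b y * bchar c y * wchar a y + bchar a y * bchar c y * wchar b y)); last first.
  by move=> y Hy; rewrite bchar_conv //; ring.
have proj f d : induced_function H (fun y => f y * wchar d y) x =
    induced_function H f x * wchar d x.
  by apply: induced_projection => t _; exact: wchar_class.
rewrite !inducedD.
rewrite (proj (fun y => bchar a y * bchar c y)) (proj (fun y => bchar a y * bchar b y)).
rewrite (proj (fun y => bchar b y * bchar c y)).
ring.
Qed.

Lemma wchar_unit x : wchar (fbasis (symbol_unit C H)) x = 1.
Proof. by rewrite char_sum_basis /= Ch_triv_dual. Qed.

Lemma bchar_unit x : bchar (fbasis (symbol_unit C H)) x = 0.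
Proof. by rewrite char_sum_basis. Qed.

Lemma bchar_triv x : H x -> bchar (fbasis (inr (triv_dual C H) : symb)) x = 1.
Proof. by move=> Hx; rewrite char_sum_basis /= Ch_triv_dual. Qed.

Lemma wchar_triv x : wchar (fbasis (inr (triv_dual C H) : symb)) x = 0.
Proof. by rewrite char_sum_basis. Qed.

(** Associativity for the symbols of tau, 1, 1 says that Ch tau is the
    quotient of the characters of two representations of G induced from H; a
    quotient of class functions on G is a class function. *)
Lemma assoc_admissible : associative conv -> admissible C H.
Proof.
move=> assoc tau tauU irr g Hg s Hs; rewrite /ch; congr (_ * _).
have [p pE] := dual_of_irreducible tauU irr.
rewrite !(Ch_equiv pE) //; set rho := dual_rep p in pE *.
have [a [Wa Ka]] : exists a,
    (forall x, wchar a x = 0) /\ forall x, bchar a x = Ch rho x.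
  by exists (fbasis (inr p : symb)); split=> x; rewrite char_sum_basis.
have [u [Wu Ku]] : exists u,
    (forall x, wchar u x = 0) /\ forall x, H x -> bchar u x = 1.
  exists (fbasis (inr (triv_dual C H) : symb)).
  by split; [exact: wchar_triv|exact: bchar_triv].
pose N x := induced_function H (Ch (triv_rep C G)) x.
have key x : H x -> Ch rho x * N x = induced_function H (Ch rho) x.
  move=> Hx; have := congr1 (fun d => bchar d x) (assoc a u u).
  rewrite (bchar_conv a (conv u u) Hx) (bchar_conv (conv a u) u Hx) (bchar_conv a u Hx).
  rewrite (wchar_conv a u) (wchar_conv u u) !Wu Wa Ka (Ku x Hx).
  rewrite !(mul0r, mulr0, add0r, addr0, mulr1) => E.
  have -> : N x = induced_function H (fun y => bchar u y * bchar u y) x.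
    by apply: induced_ext => y Hy; rewrite Ch_triv Ku // mulr1.
  by rewrite E; apply: induced_ext => y Hy; rewrite Ka Ku // mulr1.
have conj_inv sigma x y : unitary_rep H sigma ->
    induced_function H (Ch sigma) (y * x * y^-1)%g =
    induced_function H (Ch sigma) x.
  by move=> sU; rewrite -!Ch_ind Ch_conjg //; exact: unitary_ind.
have N_neq0 : N g != 0.
  rewrite /N /induced_function.
  under eq_bigr => t _ do rewrite Ch_triv -(mulrb 1 (_ \in H)).
  rewrite -natr_sum pnatr_eq0 -lt0n.
  have [i [Hi _]] := transversal_index subgroupH finite_indexH 1%g.
  rewrite big_tnth (bigD1 i) //=.
  set t := tnth _ i in Hi *; rewrite mulg1 in Hi.
  rewrite (_ : (t^-1 * g * t \in H)%g) //; apply/mem_iff.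
  rewrite -[X in (_ * X)%g]invgK.
  apply: (subgroupM subgroupH); first exact: (subgroupM subgroupH).
  exact: (subgroupV subgroupH).
apply: (mulIf N_neq0); rewrite (key g) //.
rewrite -(conj_inv _ g s (dual_unitary p)) -key //; congr (_ * _).
by apply/esym/conj_inv; exact: unitary_triv.
Qed.

End SymbolAlgebra.

(** * The axioms of a fusion rule algebra *)

Section FusionAlgebra.
Variables (C : numClosedFieldType) (G : topologicalGroupType) (H : set G).
Hypotheses (subgroupH : is_subgroup H) (closedH : closed H).
Hypothesis finite_indexH : finite_set (left_cosets H).

Local Notation symb := (symbols C H).
Local Notation CF := {formal C[symb]}.
Local Notation conv := (symbols_conv C H).
Local Notation star := (symbols_star C H).
Local Notation X0 := (symbol_unit C H).
Local Notation wchar := (char_sum (@white_class C G H)).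
Local Notation bchar := (char_sum (@black_class C G H)).

Lemma irreducible_conj (S : set G) (rho : rep C G) :
  irreducible_rep S rho -> irreducible_rep S (conj_rep rho).
Proof.
move=> [dim_gt0 irr]; split=> // U Ustab.
have [x Sx|U0|Ufull] := irr (map_mx Num.conj U).
- have -> : (rho x)^T = map_mx Num.conj (conj_rep rho x)^T.
    by apply/matrixP => i j; rewrite !mxE conjCK.
  by rewrite -map_mxM map_submx; exact: Ustab.
- by left; apply/eqP; rewrite -(map_mx_eq0 Num.conj) U0.
- by right; move: Ufull; rewrite /row_full mxrank_map.
Qed.

Lemma dual_conj (S : set G) (p : dual C S) : exists q : dual C S,
  forall x, S x -> Ch (dual_rep q) x = (Ch (dual_rep p) x)^*.
Proof.
have [q qE] := dual_of_irreducible (unitary_conj (dual_unitary p))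
  (irreducible_conj (dual_irreducible p)).
by exists q => x Sx; rewrite -(Ch_equiv qE Sx) Ch_conj.
Qed.

Lemma wchar_inl (p : dual C [set: G]) x :
  wchar (fbasis (inl p : symb)) x = Ch (dual_rep p) x.
Proof. exact: char_sum_basis. Qed.

Lemma wchar_inr (p : dual C H) x : wchar (fbasis (inr p : symb)) x = 0.
Proof. exact: char_sum_basis. Qed.

Lemma bchar_inl (p : dual C [set: G]) x : bchar (fbasis (inl p : symb)) x = 0.
Proof. exact: char_sum_basis. Qed.

Lemma bchar_inr (p : dual C H) x :
  bchar (fbasis (inr p : symb)) x = Ch (dual_rep p) x.
Proof. exact: char_sum_basis. Qed.

Lemma star_symbol (s : symb) : exists s' : symb, star (fbasis s) = fbasis s'.
Proof.
suff [s' [Ws' Ks']] : exists s' : symb,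
    (forall x, wchar (fbasis s') x = (wchar (fbasis s) x)^*) /\
    (forall x, H x -> bchar (fbasis s') x = (bchar (fbasis s) x)^*).
  exists s'; apply: symbols_eq => // x; first by rewrite wchar_star Ws'.
  by move=> Hx; rewrite bchar_star // Ks'.
case: s => p; have [q qE] := dual_conj p.
  exists (inl q); split=> [x|x Hx].
    by apply: etrans (wchar_inl q x) _; rewrite wchar_inl qE.
  by apply: etrans (bchar_inl q x) _; rewrite bchar_inl rmorph0.
exists (inr q); split=> [x|x Hx].
  by apply: etrans (wchar_inr q x) _; rewrite wchar_inr rmorph0.
by apply: etrans (bchar_inr q x) _; rewrite bchar_inr qE.
Qed.

(** The multiplicity of the trivial representation is the mean value of the
    character. *)
Lemma unit_coef_average (a : CF) m : affine_weights [set: G] m ->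
  {in coef_reps (@white_class C G H) (triv_dual C [set: G]) a,
    forall r, invariant_average [set: G] m r} ->
  fcoef X0 a = average m (wchar a).
Proof.
move=> mw mP; rewrite -(average_coef (@white_classE _ _ _) mw mP).
by apply: eq_bigr => -[c h] _ /=; rewrite Ch_triv_dual // rmorph1 mul1r.
Qed.

Lemma average_mul_dual (S : set G) (p p' q : dual C S) m :
  (forall x, S x -> Ch (dual_rep p') x = (Ch (dual_rep p) x)^*) ->
  {in m, forall c, S c.2} ->
  invariant_average S m (tens_rep (conj_rep (dual_rep p')) (dual_rep q)) ->
  average m (Ch (tens_rep (dual_rep p) (dual_rep q))) = (q == p')%:R.
Proof.
move=> pE mS mP; rewrite [q == _]eq_sym -(character_orthogonality mP).
by apply: average_ext mS _ => x Sx; rewrite !Ch_tens Ch_conj pE // conjCK.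
Qed.

(** The coefficient is a mean value over G, computed by orthogonality for two
    white symbols and by Frobenius reciprocity and orthogonality for two black
    ones. The product of two symbols of different colours is a sum of black
    symbols, and conjugation preserves colours. *)
Lemma unit_coef_mul (s s' t : symb) : star (fbasis s) = fbasis s' ->
  fcoef X0 (symbol_mul s t) = (t == s')%:R.
Proof.
move=> ss'.
pose ws (s : symb) x := oapp (fun p => Ch (dual_rep p) x) 0 (white_class s).
pose ks (s : symb) x := oapp (fun p => Ch (dual_rep p) x) 0 (black_class s).
have Wss' x : (ws s x)^* = ws s' x.
  by rewrite /ws -[in LHS]char_sum_basis -[in RHS]char_sum_basis -ss' wchar_star.
have Kss' x : H x -> (ks s x)^* = ks s' x.
  move=> Hx; rewrite /ks -[in LHS]char_sum_basis -[in RHS]char_sum_basis -ss'.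
  by rewrite bchar_star.
have black0 sigma : fcoef X0 (black H sigma) = 0.
  rewrite /black raddf_sum big1 // => r _ /=.
  by rewrite mcoeffU; case: eqP.
have dim_neq0 (S : set G) (r : dual C S) : Ch (dual_rep r) 1%g != 0.
  rewrite /Ch (rep1 (dual_unitary r)) mxtrace1 pnatr_eq0 -lt0n.
  by case: (dual_irreducible r).
have H1 := subgroup1 subgroupH.
case: s s' ss' Wss' Kss' => p [] p' ss' Wss' Kss'.
- case: t => q; last by rewrite black0.
  have p'E x : Ch (dual_rep p') x = (Ch (dual_rep p) x)^*.
    exact/esym/Wss'.
  have tU : unitary_rep [set: G] (tens_rep (dual_rep p) (dual_rep q)).
    exact: unitary_tens (dual_unitary p) (dual_unitary q).
  have [|m [mw mP]] := @exists_invariant_average C _ _ (subgroupT G)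
    (tens_rep (conj_rep (dual_rep p')) (dual_rep q) ::
      coef_reps (@white_class C G H) (triv_dual C [set: G])
        (white H (tens_rep (dual_rep p) (dual_rep q)))).
    move=> r; rewrite inE => /predU1P[->|]; last exact: coef_reps_unitary.
    exact: unitary_tens (unitary_conj (dual_unitary p')) (dual_unitary q).
  rewrite (unit_coef_average mw); last first.
    by move=> r rl; apply: mP; rewrite inE rl orbT.
  transitivity (average m (Ch (tens_rep (dual_rep p) (dual_rep q)))).
    by apply: eq_bigr => -[c h] _; rewrite wchar_white.
  rewrite (average_mul_dual (p' := p')) //; last exact: mP (mem_head _ _).
- have := Wss' 1%g; rewrite /ws /= => /eqP.
  by rewrite fmorph_eq0 (negPf (dim_neq0 _ _)).
- have := Kss' 1%g H1; rewrite /ks /= => /eqP.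
  by rewrite fmorph_eq0 (negPf (dim_neq0 _ _)).
- case: t => q; first by rewrite black0.
  have p'E x : H x -> Ch (dual_rep p') x = (Ch (dual_rep p) x)^*.
    by move=> Hx; exact/esym/Kss'.
  set sigma := tens_rep (dual_rep p) (dual_rep q).
  have sU : unitary_rep H sigma.
    exact: unitary_tens (dual_unitary p) (dual_unitary q).
  have iU : unitary_rep [set: G] (ind_rep H sigma) by exact: unitary_ind.
  have [|m [mw mP]] := @exists_invariant_average C _ _ (subgroupT G)
    (ind_rep H sigma ::
      coef_reps (@white_class C G H) (triv_dual C [set: G])
        (white H (ind_rep H sigma))).
    move=> r; rewrite inE => /predU1P[->//|]; exact: coef_reps_unitary.
  have [|m0 [m0w m0P]] := @exists_invariant_average C _ _ subgroupH
    [:: sigma; tens_rep (conj_rep (dual_rep p')) (dual_rep q)].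
    move=> r; rewrite !inE => /orP[] /eqP-> //.
    exact: unitary_tens (unitary_conj (dual_unitary p')) (dual_unitary q).
  rewrite (unit_coef_average mw); last first.
    by move=> r rl; apply: mP; rewrite inE rl orbT.
  transitivity (average m (Ch (ind_rep H sigma))).
    by apply: eq_bigr => -[c h] _; rewrite wchar_white.
  rewrite (Frobenius_average subgroupH finite_indexH sU
    (mP _ (mem_head _ _)) (m0P _ (mem_head _ _))).
  rewrite (average_mul_dual (p' := p')) //; first by case: m0w.
  by apply: m0P; rewrite !inE eqxx orbT.
Qed.

Lemma fbasis_inj (s t : symb) : fbasis s = fbasis t :> CF -> s = t.
Proof.
move=> st; have := congr1 (mcoeff t) st; rewrite !mcoeffU eqxx.
by case: eqP => // _ /eqP; rewrite eq_sym oner_eq0.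
Qed.

Lemma coef_nat_sum I (l : seq I) (f : I -> symb) (z : symb) :
  exists n : nat, fcoef z (\sum_(i <- l) fbasis (f i) : CF) = n%:R.
Proof.
exists (\sum_(i <- l) (f i == z))%N; rewrite raddf_sum natr_sum.
by apply: eq_bigr => i _ /=; rewrite mcoeffU; case: eqP.
Qed.

Lemma admissible_fusion_rule_algebra : countable [set: symb] ->
  admissible C H -> fusion_rule_algebra X0 conv star.
Proof.
move=> countS adm; split=> //.
- exact: bilinear_ext_linearl.
- exact: bilinear_ext_linearr.
- exact: admissible_assoc.
- move=> a; apply: symbols_eq => // x; last first.
    by move=> Hx; rewrite bchar_conv // wchar_unit bchar_unit mul1r mul0r addr0.
  rewrite wchar_conv // wchar_unit mul1r -[RHS]addr0; congr (_ + _).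
  rewrite -[RHS](@induced0 C G H x).
  by apply: induced_ext => y _; rewrite bchar_unit mul0r.
- move=> a; apply: symbols_eq => // x; last first.
    by move=> Hx; rewrite bchar_conv // wchar_unit bchar_unit mulr1 mulr0 add0r.
  rewrite wchar_conv // wchar_unit mulr1 -[RHS]addr0; congr (_ + _).
  rewrite -[RHS](@induced0 C G H x).
  by apply: induced_ext => y _; rewrite bchar_unit mulr0.
- exact: conj_linear_ext_linear.
- move=> a; apply: symbols_eq => // x; first by rewrite !wchar_star conjCK.
  by move=> Hx; rewrite !bchar_star // conjCK.
- move=> a b; apply: symbols_eq => // x; last first.
    move=> Hx; rewrite bchar_conv // !bchar_star // !wchar_star bchar_conv // rmorphD !rmorphM.
    by rewrite addrC mulrC [X in _ + X]mulrC.
  rewrite wchar_conv // !wchar_star wchar_conv // rmorphD rmorphM mulrC; congr (_ + _).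
  rewrite /induced_function rmorph_sum; apply: eq_bigr => t _.
  by case: ifP => [/mem_iff Ht|_]; rewrite ?rmorph0 // rmorphM !bchar_star // mulrC.
- move=> s t z; rewrite [conv _ _]bilinear_ext_basis.
  by case: s t => p [] q; exact: coef_nat_sum.
- exact: star_symbol.
- move=> s t; have [s' ss'] := star_symbol s.
  rewrite [conv _ _]bilinear_ext_basis (unit_coef_mul t ss') ss'.
  rewrite pnatr_eq0 eqb0 negbK.
  by split=> [/fbasis_inj/eqP|/eqP->].
- move=> s t; have [s' ss'] := star_symbol s.
  rewrite [conv _ _]bilinear_ext_basis (unit_coef_mul t ss') ss' => /fbasis_inj->.
  by rewrite eqxx.
Qed.

End FusionAlgebra.

(** * The equivalence *)

Section Main.
Variables (C : numClosedFieldType) (G : topologicalGroupType) (H : set G).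
Hypothesis archiC : forall x : C, exists n : nat, `|x| < n%:R.
Variable dense : nat -> C.
Hypothesis denseP : forall x e : C, 0 < e -> exists n, `|x - dense n| < e.

Lemma countable_sum (A B : Type) :
  countable [set: A] -> countable [set: B] -> countable [set: A + B].
Proof.
move=> /countable_injP[f fI] /countable_injP[g gI]; apply/countable_injP.
exists (fun s => choice.pickle
  (match s with inl a => (true, f a) | inr b => (false, g b) end)).
move=> s t _ _ /(pcan_inj (@choice.pickleK _)).
case: s t => a [] b // [ab]; [congr inl; apply: fI|congr inr; apply: gI] => //;
by rewrite in_setT.
Qed.

(** The archimedean property and the density of a sequence in C serve to prove
    that the duals are countable. *)
Theorem fusion_rule_algebra_iff_admissible :
  compact [set: G] -> @second_countable G -> is_subgroup H -> closed H ->
  finite_set (left_cosets H) ->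
  fusion_rule_algebra (symbol_unit C H) (symbols_conv C H) (symbols_star C H)
  <-> admissible C H.
Proof.
move=> compactG scG subgroupH closedH finite_indexH; split=> [[_ _ _ assoc *]|adm].
  exact: assoc_admissible assoc.
apply: admissible_fusion_rule_algebra => //; apply: countable_sum.
  exact: (countable_dual (subgroupT G) archiC denseP).
apply: (countable_dual subgroupH archiC denseP) => //.
exact: subclosed_compact closedH compactG _.
Qed.
End Main.


(** * The complex numbers *)

Section ComplexNumbers.
Variable R : realType.
Local Open Scope complex_scope.

Lemma complex_archimedean (x : R[i]) : exists n : nat, `|x| < n%:R.
Proof.
rewrite normc_def; set r := Num.sqrt _.
exists (Num.bound r); rewrite -(rmorph_nat (real_complex R)) ltcR.
by apply: archi_boundP; exact: sqrtr_ge0.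
Qed.

Lemma rational_near (x e : R) : 0 < e -> exists q : rat, (x - ratr q) ^+ 2 < e ^+ 2.
Proof.
move=> e0; have xe : x - e < x + e by rewrite ltrD2l gtrN.
have [q] := rat_in_itvoo xe; rewrite in_itv /= => /andP[q1 q2]; exists q.
rewrite -[X in X < _]real_normK ?num_real // ltr_pXn2r ?nnegrE ?(ltW e0) //.
by rewrite ltr_norml; lra.
Qed.

Lemma complex_separable : exists dense : nat -> R[i],
  forall x e : R[i], 0 < e -> exists n, `|x - dense n| < e.
Proof.
pose D (n : nat) : R[i] :=
  if choice.unpickle n is Some (a, b)
  then (ratr (a : rat)) +i* (ratr (b : rat)) else 0.
exists D => -[x y] e e0.
have eE : e = (complex.Re e)%:C by rewrite RRe_real // gtr0_real.
move: e0; rewrite eE; move: (complex.Re e) => r {eE e}.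
rewrite -[0]/(0%:C) ltcR => r0.
have r2 : 0 < r / 2%:R by rewrite divr_gt0 // ltr0n.
have [a aP] := rational_near x r2; have [b bP] := rational_near y r2.
exists (choice.pickle (a, b)); rewrite /D choice.pickleK.
rewrite -(@ltr_pXn2r _ 2) ?nnegrE //; last by rewrite ler0c ltW.
rewrite -add_Re2_Im2 -rmorphXn /= ltcR.
apply: (lt_le_trans (ltrD aP bP)).
rewrite expr_div_n; have := exprn_ge0 2 (ltW r0); set r' := r ^+ 2.
rewrite -natrX; lra.
Qed.
End ComplexNumbers.

Theorem mainTheorem1 (R : realType) (G : topologicalGroupType) (G0 : set G)
  (compactG : compact [set: G]) (hausdorffG : hausdorff_space G)
  (second_countableG : @second_countable G)
  (subgroupG0 : is_subgroup G0) (closedG0 : closed G0)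
  (finite_indexG0 : finite_set (left_cosets G0)) :
  fusion_rule_algebra (symbol_unit R[i] G0) (symbols_conv R[i] G0)
    (symbols_star R[i] G0)
  <-> admissible R[i] G0.
Proof.
have [dense denseP] := complex_separable R.
exact: (fusion_rule_algebra_iff_admissible (@complex_archimedean R) denseP
  compactG second_countableG subgroupG0 closedG0 finite_indexG0).
Qed.
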